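(* Let $h(n,n)=\operatorname{hdepth}(S_{n,n}/I_{n,n})$, where $S_{n,n}=K[x_1,\ldots,x_n,y_1,\ldots,y_n]$ and $I_{n,n}=(x_iy_j : 1\leq i,j\leq n)$. Then for all integers $n\geq 2$, $$ \left\lfloor \frac{n}{2} + \sqrt{\left\lfloor \frac{n}{2}\right\rfloor \ln 2} \right\rfloor - 1 \;\leq\; h(n,n) \;\leq\; \left\lfloor \frac{n+1}{2} + \sqrt{\left\lfloor \frac{n}{2}\right\rfloor \ln 2} \right\rfloor .$$
   Context: $K$ is a field. Polynomial rings over $K$ carry the standard grading (each variable has degree 1). For a finitely generated graded module $M$ over a polynomial ring $S$ over $K$, the Hilbert depth $\operatorname{hdepth}(M)$ is the maximal depth of a finitely generated graded $S$-module $N$ having the same Hilbert series as $M$. *)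

(* Defs.v *)
From HB Require Import structures.
From mathcomp Require Import all_boot all_order all_algebra.
From mathcomp Require Import ring_quotient boolp.
From mathcomp Require Import mpoly.

Set Implicit Arguments.
Unset Strict Implicit.
Unset Printing Implicit Defensive.

Import Order.TTheory GRing.Theory Num.Theory.
Local Open Scope ring_scope.
Local Open Scope quotient_scope.

Section Ideals.
Variables (K : fieldType) (m : nat) (I : finType) (g : I -> {mpoly K[m]}).
Local Notation S := {mpoly K[m]}.

Definition ideal_gen (p : S) : Prop := exists c : I -> S, p = \sum_i c i * g i.

Definition in_ideal : {pred S} := fun p => `[< ideal_gen p >].

Lemma in_ideal_zmod_closed : zmod_closed in_ideal.
Proof.
split=> [|p q /asboolP[a ->] /asboolP[b ->]]; apply/asboolP.
  by exists (fun=> 0); rewrite big1 // => i _; rewrite mul0r.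
exists (fun i => a i - b i); rewrite -sumrB.
by apply: eq_bigr => i _; rewrite mulrBl.
Qed.

HB.instance Definition _ := GRing.isZmodClosed.Build S in_ideal
  in_ideal_zmod_closed.

Lemma in_idealM a p : p \in in_ideal -> a * p \in in_ideal.
Proof.
move=> /asboolP[c ->]; apply/asboolP; exists (fun i => a * c i).
by rewrite mulr_sumr; apply: eq_bigr => i _; rewrite mulrA.
Qed.

Definition quot_ring := {ideal_quot in_ideal}.

HB.instance Definition _ := GRing.Zmodule.on quot_ring.

Local Notation pi := (\pi_({ideal_quot in_ideal})).

Definition quot_scale (a : S) (x : quot_ring) : quot_ring := pi (a * repr x).

Lemma quot_scale_pi a p : quot_scale a (pi p) = pi (a * p).
Proof.
apply/eqP; rewrite -Quotient.idealrBE -mulrBr; apply: in_idealM.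
by rewrite Quotient.idealrBE reprK.
Qed.

Lemma quot_reprK (x : quot_ring) : pi (repr x) = x.
Proof. exact: reprK. Qed.

Fact quot_scaleA a b x : quot_scale a (quot_scale b x) = quot_scale (a * b) x.
Proof. by rewrite -[x]quot_reprK !quot_scale_pi mulrA. Qed.

Fact quot_scale1 : left_id 1 quot_scale.
Proof. by move=> x; rewrite -[x]quot_reprK quot_scale_pi mul1r. Qed.

Fact quot_scaleDr : right_distributive quot_scale +%R.
Proof.
move=> a x y; rewrite -[x]quot_reprK -[y]quot_reprK -[_ + _]raddfD !quot_scale_pi.
by rewrite mulrDr raddfD.
Qed.

Fact quot_scaleDl x : {morph quot_scale^~ x : a b / a + b}.
Proof. by move=> a b; rewrite -[x]quot_reprK !quot_scale_pi mulrDl raddfD. Qed.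

HB.instance Definition _ := GRing.Zmodule_isLmodule.Build S quot_ring
  quot_scaleA quot_scale1 quot_scaleDr quot_scaleDl.

End Ideals.

Section GradedModules.
Variables (K : fieldType) (m : nat).
Local Notation S := {mpoly K[m]}.

(* [gcomp M d] is the homogeneous component M_d; the last two axioms say that
   M is the internal direct sum of its components. *)
Record gmodule := GModule {
  gcarrier :> lmodType S;
  gcomp : int -> gcarrier -> Prop;
  gcomp0 : forall d, gcomp d 0;
  gcompB : forall d u v, gcomp d u -> gcomp d v -> gcomp d (u - v);
  gcompZ : forall (e : nat) d (p : S) u,
    p \is e.-homog -> gcomp d u -> gcomp (e%:Z + d) (p *: u);
  gcomp_span : forall u, exists (r : seq int) (c : int -> gcarrier),
    (forall d, gcomp d (c d)) /\ u = \sum_(d <- r) c d;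
  gcomp_free : forall (r : seq int) (c : int -> gcarrier),
    uniq r -> (forall d, gcomp d (c d)) -> \sum_(d <- r) c d = 0 ->
    forall d, d \in r -> c d = 0
}.

Definition fin_gen (M : gmodule) : Prop :=
  exists (k : nat) (g : 'I_k -> M),
    forall u, exists c : 'I_k -> S, u = \sum_(i < k) c i *: g i.

(* dim_K M_d = k: the component M_d has a K-basis of k elements. *)
Definition comp_dim (M : gmodule) (d : int) (k : nat) : Prop :=
  exists b : 'I_k -> M, (forall i, gcomp d (b i)) /\
    forall u, gcomp d u ->
      exists! c : 'rV[K]_k, u = \sum_(i < k) (c 0 i)%:MP *: b i.

Definition same_hilbert_series (M N : gmodule) : Prop :=
  forall d, exists k, comp_dim M d k /\ comp_dim N d k.

Definition max_ideal : {pred S} := in_ideal (fun i : 'I_m => 'X_i : S).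

(* u lies in the submodule (f_1, ..., f_r) M, where fs = [:: f_1; ...; f_r]. *)
Definition in_mul (M : gmodule) (fs : seq S) (u : M) : Prop :=
  exists c : 'I_(size fs) -> M, u = \sum_(i < size fs) fs`_i *: c i.

Definition regular_seq (M : gmodule) (fs : seq S) : Prop :=
  (forall i, (i < size fs)%N -> forall u : M,
     in_mul (take i fs) (fs`_i *: u) -> in_mul (take i fs) u)
  /\ exists u : M, ~ in_mul fs u.

(* depth M is the maximal length of an M-regular sequence contained in the
   graded maximal ideal. *)
Definition is_depth (M : gmodule) (r : nat) : Prop :=
  (exists fs, [/\ {subset fs <= max_ideal}, regular_seq M fs & size fs = r]) /\
  (forall fs, {subset fs <= max_ideal} -> regular_seq M fs ->
     (size fs <= r)%N).

Definition is_hdepth (M : gmodule) (h : nat) : Prop :=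
  (exists N : gmodule,
     [/\ fin_gen N, same_hilbert_series N M & is_depth N h]) /\
  (forall (N : gmodule) (r : nat),
     fin_gen N -> same_hilbert_series N M -> is_depth N r -> (r <= h)%N).

End GradedModules.

Section GradedQuotient.
Variables (K : fieldType) (m : nat) (I : finType) (g : I -> {mpoly K[m]}).
Variables (e : I -> nat) (g_homog : forall i, g i \is (e i).-homog).
Local Notation S := {mpoly K[m]}.
Local Notation Q := (quot_ring g).
Local Notation pi := (\pi_({ideal_quot (in_ideal g)})).
Local Notation pih d := (@pihomog m K mdeg d).

Definition poly_comp (d : int) (p : S) : bool :=
  if d is Posz n then p \is n.-homog else p == 0.

Definition quot_comp (d : int) (x : Q) : Prop :=
  exists2 p : S, poly_comp d p & x = pi p.

Lemma pihomogMr (c p : S) d n : p \is n.-homog ->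
  pih d (c * p) = if (n <= d)%N then pih (d - n)%N c * p else 0.
Proof.
move=> hp; rewrite {1}(pihomog_partitionE (leqnn (mmeasure mdeg c))).
rewrite mulr_suml linear_sum /=.
have hM (i : nat) : pih i c * p \is (i + n)%N.-homog.
  by apply: dhomogM => //; apply: pihomogP.
case: leqP => [le_nd|lt_dn]; last first.
  rewrite big1 // => i _; apply: pihomog_ne0 (hM i).
  by rewrite neq_ltn (leq_trans lt_dn) ?leq_addl ?orbT.
case: (ltnP (d - n) (mmeasure mdeg c)) => [lt|ge].
  rewrite (bigD1 (Ordinal lt)) //= big1 ?addr0.
    by rewrite pihomog_dE // -{2}(subnK le_nd).
  move=> i /eqP ne; apply: pihomog_ne0 (hM i).
  by apply/eqP => E; apply: ne; apply: val_inj; rewrite /= -E addnK.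
rewrite big1 => [|i _].
  rewrite pihomogE big_seq_cond big_pred0 ?mul0r // => k.
  apply/negP => /andP[/mmeasure_mnm_lt lt /eqP E].
  by move: (leq_trans (lt mdeg) ge); rewrite E ltnn.
apply: pihomog_ne0 (hM i); apply/eqP => E.
by move: (leq_trans (ltn_ord i) ge); rewrite -E addnK ltnn.
Qed.

Lemma in_ideal_pihomog d p : p \in in_ideal g -> pih d p \in in_ideal g.
Proof.
move=> /asboolP[c ->]; rewrite linear_sum /= rpred_sum // => i _.
rewrite (pihomogMr _ _ (g_homog i)); case: ifP => _; last exact: rpred0.
apply: in_idealM; apply/asboolP; exists (fun j => (j == i)%:R).
rewrite (bigD1 i) //= eqxx mul1r big1 ?addr0 // => j /negPf ->.
by rewrite mul0r.
Qed.

Fact quot_comp0 d : quot_comp d 0.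
Proof.
by exists 0; [case: d => n //=; rewrite ?rpred0|rewrite raddf0].
Qed.

Fact quot_compB d x y : quot_comp d x -> quot_comp d y -> quot_comp d (x - y).
Proof.
move=> [p hp ->] [q hq ->]; exists (p - q); last by rewrite raddfB.
by case: d hp hq => n /=; [exact: rpredB|move=> /eqP-> /eqP->; rewrite subrr].
Qed.

Fact quot_compZ (n : nat) d (p : S) x :
  p \is n.-homog -> quot_comp d x -> quot_comp (n%:Z + d) (p *: x).
Proof.
move=> hp [q hq ->]; case: d hq => k /= hq.
  by exists (p * q); [exact: dhomogM|exact: quot_scale_pi].
rewrite (eqP hq) raddf0 scaler0; exact: quot_comp0.
Qed.

Fact quot_comp_span x : exists (r : seq int) (c : int -> Q),
  (forall d, quot_comp d (c d)) /\ x = \sum_(d <- r) c d.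
Proof.
pose p := repr x; pose k := mmeasure mdeg p.
exists [seq Posz i | i <- iota 0 k].
exists (fun d => pi (if d is Posz i then pih i p else 0)); split.
  by move=> d; eexists; [|reflexivity]; case: d => i //=; apply: pihomogP.
rewrite big_map; transitivity (pi p); first by rewrite quot_reprK.
rewrite [in LHS](pihomog_partitionE (leqnn k)) raddf_sum.
by rewrite -(big_mkord xpredT (fun i => pi (pih i p))) /index_iota subn0.
Qed.

Fact quot_comp_free (r : seq int) (c : int -> Q) :
  uniq r -> (forall d, quot_comp d (c d)) -> \sum_(d <- r) c d = 0 ->
  forall d, d \in r -> c d = 0.
Proof.
move=> ur hc s0 d dr.
have /choice[p hp] d' : exists p, poly_comp d' p /\ c d' = pi p.
  by have [p] := hc d'; exists p.
have pi0 q : (pi q == 0) = (q \in in_ideal g).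
  by rewrite -[q in RHS]subr0 Quotient.idealrBE raddf0.
have /eqP : pi (\sum_(i <- r) p i) = 0.
  by rewrite raddf_sum -[RHS]s0; apply: eq_bigr => i _; case: (hp i).
rewrite pi0 => hI; have [hd ->] := hp d; apply/eqP; rewrite pi0.
case: d dr hd => n dr /= hd; last by rewrite (eqP hd) rpred0.
have := in_ideal_pihomog n hI; rewrite linear_sum (bigD1_seq (Posz n)) //=.
rewrite pihomog_dE // big1 ?addr0 // => -[k|k] ne; have [/= hk _] := hp (Posz k).
  exact: pihomog_ne0 hk.
by have [/= /eqP-> _] := hp (Negz k); rewrite pihomog0.
Qed.

Definition quot_gmodule : gmodule K m :=
  GModule quot_comp0 quot_compB quot_compZ quot_comp_span quot_comp_free.

End GradedQuotient.

Section BipartiteEdgeIdeal.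
Variables (K : fieldType) (n : nat).

(* The variables of {mpoly K[n + n]} are x_1, ..., x_n, y_1, ..., y_n. *)
Definition xvar (i : 'I_n) : {mpoly K[n + n]} := 'X_(lshift n i).
Definition yvar (j : 'I_n) : {mpoly K[n + n]} := 'X_(rshift n j).

Definition Igen (ij : 'I_n * 'I_n) : {mpoly K[n + n]} := xvar ij.1 * yvar ij.2.

Lemma Igen_homog ij : Igen ij \is 2.-homog.
Proof. by apply: (@dhomogM _ _ _ 1%N _ 1%N); rewrite dhomogX /= mdeg1. Qed.

Definition SI_gmodule : gmodule K (n + n) := quot_gmodule Igen_homog.

End BipartiteEdgeIdeal.

(* Main.v *)
Require Import Defs.
From HB Require Import structures.
From mathcomp Require Import all_boot all_order all_algebra.
From mathcomp Require Import reals exp.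
From mathcomp Require Import sequences ring lra.
From mathcomp Require Import fraction ring_quotient boolp zify.
From mathcomp Require Import mpoly.

(* Write H for the Hilbert series of S/I. Both bounds rest on the coefficients
   2 C(n-r+k-1, k) - (-1)^k C(r, k) of (1-t)^r H for r <= n.

   Upper bound. If N has a regular sequence of length r in the maximal ideal, not
   necessarily homogeneous, then the cohomology of N with respect to x_1, ..., x_m
   vanishes in degrees < r. This vanishing is a condition on the homogeneous
   components, survives the base change K -> K(t), and forces the linear form
   l = sum_i t^i x_i to be regular (McCoy), after which N/lN has vanishing
   cohomology in degrees < r-1. By induction (1-t)^r H_N has nonnegative
   coefficients, over any field K.

   Lower bound. If (1-t)^r H has nonnegative coefficients, then H is the Hilbert
   series of a finite direct sum of shifted polynomial rings in at least r
   variables, on which x_1, ..., x_r is a regular sequence.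

   Numerically, with p = n-r, the quotient of C(r, k) by C(p+k-1, k) is the product
   of the (r-i)/(p+i) for i < k, which 1 + x <= exp x bounds on both sides. *)

Set Implicit Arguments.
Unset Strict Implicit.
Unset Printing Implicit Defensive.

Import Order.TTheory GRing.Theory Num.Theory.
Local Open Scope ring_scope.

(** * Non-alternating cochains and their coboundary *)

Section Cochains.
Variable I : Type.

(* Cochains of degree j are V-valued functions on j-tuples of indices; unlike in
   the Koszul complex they need not be alternating, which spares all signs while
   multiplication by x_i stays null-homotopic through c |-> c (i :: _). *)
Fixpoint cobord (V W : zmodType) (x : I -> {additive V -> W}) (s : seq I)
    (c : seq I -> V) : W :=
  if s is i :: s' then x i (c s') - cobord x s' (fun q => c (i :: q)) else 0.

(** Cochains are total functions on lists, but a coboundary sees a single length; this permits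
    arbitrary default values at all other lengths. *)
Lemma eq_cobord (V W : zmodType) (x : I -> {additive V -> W}) s c c' :
  (forall q, (size q).+1 = size s -> c q = c' q) -> cobord x s c = cobord x s c'.
Proof.
elim: s c c' => [//|i s IH] c c' eqc /=; rewrite eqc //; congr (_ - _).
by apply: IH => q sq; apply: eqc; rewrite /= sq.
Qed.

Lemma cobordB (V W : zmodType) (x : I -> {additive V -> W}) s c c' :
  cobord x s (fun q => c q - c' q) = cobord x s c - cobord x s c'.
Proof.
elim: s c c' => [|i s IH] c c' /=; first by rewrite subr0.
by rewrite IH raddfB !opprD opprK addrACA.
Qed.

Lemma cobord_sum (V W : zmodType) (x : I -> {additive V -> W}) (J : Type)
    (r : seq J) s (c : J -> seq I -> V) :
  cobord x s (fun q => \sum_(k <- r) c k q) = \sum_(k <- r) cobord x s (c k).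
Proof.
elim: s c => [|i s IH] c /=; first by rewrite big1.
by rewrite IH raddf_sum -sumrB.
Qed.

Lemma cobord_morph (V W V' W' : zmodType) (x : I -> {additive V -> W})
    (x' : I -> {additive V' -> W'}) (f : V -> V') (g : {additive W -> W'}) s c :
  (forall i v, g (x i v) = x' i (f v)) ->
  g (cobord x s c) = cobord x' s (fun q => f (c q)).
Proof.
move=> gx; elim: s c => [|i s IH] c /=; first by rewrite raddf0.
by rewrite raddfB gx IH.
Qed.

(** This is d d = 0. Expanding the first index i on both levels leaves twice the coboundary of x_i
    c, with opposite signs once y_i is moved inside by commutation. *)
Lemma cobord_cobord (U V W : zmodType) (x : I -> {additive U -> V})
    (y : I -> {additive V -> W}) s c :
  (forall i j u, y i (x j u) = y j (x i u)) ->
  cobord y s (fun q => cobord x q c) = 0.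
Proof.
move=> yx; elim: s c => [//|i s IH] c /=.
rewrite cobordB IH subr0 (cobord_morph (x' := y) (f := x i)) ?subrr //.
Qed.

Lemma cobord_closed (V W : zmodType) (x : I -> {additive V -> W})
    (P : W -> Prop) s c :
  P 0 -> (forall u v, P u -> P v -> P (u - v)) ->
  (forall i q, (size q).+1 = size s -> P (x i (c q))) -> P (cobord x s c).
Proof.
move=> P0 PB; elim: s c => [//|i s IH] c Px /=.
by apply: PB; [exact: Px | apply: IH => j q sq; apply: Px; rewrite /= sq].
Qed.

End Cochains.

(** * Linear algebra over the fraction field of L[t] *)

Lemma fracP (R : idomainType) (x : {fraction R}) :
  exists ba : R * R, ba.2 != 0 /\ tofrac ba.2 * x = tofrac ba.1.
Proof.
elim/quotW: x => r; exists (\n_r, \d_r); split; first exact: denom_ratioP.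
rewrite /GRing.mul /= !piE; apply/eqmodP.
rewrite /= FracField.equivfE !numden_Ratio ?oner_neq0 ?mul1r ?mulr1 ?denom_ratioP //.
Qed.

Section FractionCoefficients.
Variable L : fieldType.
Local Notation P := {poly L}.
Local Notation F := {fraction {poly L}}.
Local Notation toF := (@tofrac {poly L}).
Local Notation iota := (toF \o polyC).

Lemma common_denominator (T : finType) (h : nat) (v : T -> 'rV[F]_h) :
  exists (a : F) (u : T -> 'rV[P]_h),
    a != 0 /\ forall t, a *: v t = map_mx toF (u t).
Proof.
have /choice[nd ndP] := @fracP P.
pose D t j := (nd (v t 0 j)).2.
have D0 t j : D t j != 0 by case: (ndP (v t 0 j)).
exists (toF (\prod_t \prod_j D t j)).
(* Each numerator is multiplied by all the denominators except its own. *)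
exists (fun t => \row_j ((\prod_(s | s != t) \prod_k D s k) *
   (\prod_(k | k != j) D t k) * (nd (v t 0 j)).1)); split.
  rewrite tofrac_eq0; apply/prodf_neq0 => t _; exact/prodf_neq0.
move=> t; apply/rowP => j; rewrite !mxE.
rewrite (bigD1 t) //= (bigD1 j) //= !rmorphM /=.
have [_ <-] := ndP (v t 0 j).
by rewrite -/(D t j) -!mulrA mulrCA [RHS]mulrCA; congr (_ * _); rewrite mulrCA.
Qed.

Lemma map_coefp_mulmx (m n p k : nat) (u : 'M[P]_(m, n)) (A : 'M[L]_(n, p)) :
  map_mx (coefp k) (u *m map_mx polyC A) = map_mx (coefp k) u *m A.
Proof.
apply/matrixP => i j; rewrite !mxE /= coef_sum; apply: eq_bigr => l _.
by rewrite !mxE coefMC.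
Qed.

(** Membership in the row space of [W] is the vanishing of the product with its cokernel matrix.
    That matrix has entries in L, so the product is computed separately for each power of t. *)
Lemma submx_frac (h k : nat) (u : 'rV[P]_h) (W : 'M[L]_(k, h)) :
  (map_mx toF u <= map_mx iota W)%MS
  <-> forall p, (map_mx (coefp p) u <= W)%MS.
Proof.
have -> : (map_mx toF u <= map_mx iota W)%MS =
    (map_mx toF (u *m map_mx polyC (cokermx W)) == 0).
  rewrite submxE -map_cokermx (map_mxM toF); congr (_ *m _ == 0).
  by apply/matrixP => i j; rewrite !mxE.
split=> [/eqP u0 p | uW].
  rewrite submxE -map_coefp_mulmx; apply/eqP; apply/rowP => j.
  move/rowP/(_ j): u0; rewrite !mxE => /eqP; rewrite tofrac_eq0 => /eqP ->.
  exact: raddf0.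
apply/eqP; apply/rowP => j; rewrite !mxE; apply/eqP; rewrite tofrac_eq0.
apply/eqP; apply/polyP => p; rewrite coef0.
move: (uW p); rewrite submxE -map_coefp_mulmx => /eqP/rowP/(_ j).
by rewrite !mxE.
Qed.

End FractionCoefficients.

(** * Graded modules in matrix form and McCoy's theorem *)

Definition mxact (L : nzRingType) (m : nat) (h : nat -> nat)
    (X : 'I_m -> forall d, 'M[L]_(h d, h d.+1)) (d : nat) (i : 'I_m) :
  {additive 'rV[L]_(h d) -> 'rV[L]_(h d.+1)} := mulmxr (X i d).

Section MatrixModules.
Variables (L : fieldType) (m : nat) (h : nat -> nat).
Variable X : 'I_m -> forall d, 'M[L]_(h d, h d.+1).
Variable W : forall d, 'M[L]_(h d).

Definition mxcommuting : Prop :=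
  forall i j d, X i d *m X j d.+1 = X j d *m X i d.+1.

(** The module is presented as V/W, with W_d the row space of [W d]: dividing by a linear form then
    enlarges [W] and leaves the spaces V_d and the matrices [X] as they are. *)
Definition mxstable : Prop := forall i d, (W d *m X i d <= W d.+1)%MS.

(* The cohomology of V/W vanishes in degrees < r. Degrees are shifted by one
   (V_0 = 0 below), so that the preimage b always lives in some V_d. *)
Definition mxexact (r : nat) : Prop :=
  forall j, (j < r)%N -> forall d (c : seq 'I_m -> 'rV[L]_(h d.+1)),
    (forall s, size s = j.+1 -> (cobord (mxact X d.+1) s c <= W d.+2)%MS) ->
    exists b : seq 'I_m -> 'rV[L]_(h d),
      forall s, size s = j -> (c s - cobord (mxact X d) s b <= W d.+1)%MS.

Hypotheses (Xcomm : mxcommuting) (Wstable : mxstable).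

Lemma submx_act d i (v : 'rV_(h d)) :
  (v <= W d)%MS -> (v *m X i d <= W d.+1)%MS.
Proof. by move=> vW; apply: submx_trans (Wstable i d); apply: submxMr. Qed.

Lemma submx_cobord d s (c : seq 'I_m -> 'rV_(h d)) :
  (forall q, (size q).+1 = size s -> (c q <= W d)%MS) ->
  (cobord (mxact X d) s c <= W d.+1)%MS.
Proof.
move=> cW; apply: (cobord_closed (P := fun v => (v <= W d.+1)%MS)).
- exact: sub0mx.
- by move=> u v uW vW; rewrite addmx_sub // eqmx_opp.
- by move=> i q sq; apply: submx_act; apply: cW.
Qed.

Hypothesis h0 : h 0 = 0%N.

(** Vanishing of the cohomology in degree 0 says that no nonzero class of V/W is killed by every
    x_i. [mxexact] says so only from V_1 on, but V_0 = 0. *)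
Lemma mxexact_socle r : mxexact r.+1 -> forall d (v : 'rV_(h d)),
  (forall i, (v *m X i d <= W d.+1)%MS) -> (v <= W d)%MS.
Proof.
move=> exX [|d] v vX.
  suff -> : v = 0 by exact: sub0mx.
  by apply/rowP => -[j lt_j]; exfalso; rewrite h0 in lt_j.
have [//|s sz|b bP] := exX 0%N _ d (fun=> v).
  by case: s sz => [//|i [|//]] _ /=; rewrite subr0; exact: vX.
by have := bP [::] erefl; rewrite /= subr0.
Qed.

(* McCoy's theorem for the polynomial sum_i t^i X_i acting on (V/W)[t]: if the
   top coefficient of u is killed by X_i modulo W, then X_i u has fewer terms. *)
Lemma mccoy T : (forall d (v : 'rV_(h d)),
    (forall i, (v *m X i d <= W d.+1)%MS) -> (v <= W d)%MS) ->
  forall d (u : nat -> 'rV_(h d)), (forall p, (T <= p)%N -> (u p <= W d)%MS) ->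
  (forall k, ((\sum_(i < m) (if (i <= k)%N then u (k - i)%N *m X i d else 0))%R
     <= W d.+1)%MS) ->
  forall p, (u p <= W d)%MS.
Proof.
move=> socle; elim: T => [|T IH] d u uT usum p; first exact: uT.
(* Descending induction on i. In the coefficient of t^(i+T) the terms with j > i are covered by the
   induction hypothesis, and those with j < i involve only [u] beyond T. *)
have uX : forall q i, (u T *m X i d <= W d.+1)%MS /\ (u q *m X i d <= W d.+1)%MS.
  move=> q i; move: q; have [k] := ubnP (m - i)%N.
  elim: k i => [//|k IHk] i lt_k.
  have uTi : (u T *m X i d <= W d.+1)%MS.
    have := usum (i + T)%N; rewrite (bigD1 i) //= leq_addr addKn.
    set z := \sum_(_ | _) _ => uz; rewrite -[_ *m _](addrK z).
    rewrite addmx_sub // eqmx_opp; apply: summx_sub => j ne_ji.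
    case: leqP => _; last exact: sub0mx.
    have [lt_ij|lt_ji|/val_inj eq_ij] := ltngtP i j.
    - have : (m - j < k)%N.
        by rewrite (leq_trans _ (_ : m - i <= k)%N) // ltn_sub2l.
      by move=> lt_jk; case: (IHk j lt_jk (i + T - j)%N).
    - apply: submx_act; apply: uT; rewrite -addnBAC ?(ltnW lt_ji) //.
      by rewrite -[T.+1]add1n leq_add2r subn_gt0.
    - by rewrite eq_ij eqxx in ne_ji.
  (* As [u T] is killed by X_i, the polynomial u X_i has only T terms left. By commutativity it is
     still annihilated by the form, so the outer induction applies one degree higher. *)
  move=> q; split=> //; move: q; apply: (IH _ (fun q => u q *m X i d)) => q.
    rewrite leq_eqVlt => /predU1P[<- //|lt_Tq].
    by apply: submx_act; apply: uT.
  rewrite (_ : \sum_(_ < m) _ =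
    (\sum_(j < m) (if (j <= q)%N then u (q - j)%N *m X j d else 0)) *m X i d.+1).
    exact: submx_act.
  rewrite mulmx_suml; apply: eq_bigr => j _.
  by case: ifP => _; rewrite ?mul0mx // -!mulmxA Xcomm.
by apply: socle => i; case: (uX p i).
Qed.

End MatrixModules.

(** * Dividing by a regular linear form *)

Section LinearForm.
Variables (F : fieldType) (m : nat) (h : nat -> nat).
Variable X : 'I_m -> forall d, 'M[F]_(h d, h d.+1).
Variable W : forall d, 'M[F]_(h d).
Variable t : F.

Definition mxform d : 'M[F]_(h d, h d.+1) := \sum_(i < m) t ^+ i *: X i d.

(** The form has degree 1, so its image contains nothing in degree 0. *)
Definition mxquot d : 'M[F]_(h d) :=
  match d return 'M[F]_(h d) with
  | 0 => W 0
  | e.+1 => (W e.+1 + mxform e)%MS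
  end.

Hypotheses (Xcomm : mxcommuting X) (Wstable : mxstable X W).

Lemma mxform_comm i d : X i d *m mxform d.+1 = mxform d *m X i d.+1.
Proof.
rewrite mulmx_sumr mulmx_suml; apply: eq_bigr => j _.
by rewrite -scalemxAr -scalemxAl Xcomm.
Qed.

Lemma mxquot_stable : mxstable X mxquot.
Proof.
move=> i [|d] /=; first exact: submx_trans (Wstable i 0) (addsmxSl _ _).
rewrite addsmxMr addsmx_sub.
rewrite (submx_trans (Wstable i d.+1)) ?addsmxSl //=.
by rewrite -mxform_comm (submx_trans _ (addsmxSr _ _)) // submxMl.
Qed.

Hypothesis form_inj : forall d (v : 'rV_(h d)),
  (v *m mxform d <= W d.+1)%MS -> (v <= W d)%MS.

Lemma submx_form d (v : 'rV_(h d)) :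
  (v <= W d)%MS -> (v *m mxform d <= W d.+1)%MS.
Proof.
move=> vW; rewrite mulmx_sumr.
by apply: summx_sub => i _; rewrite -scalemxAr scalemx_sub // submx_act.
Qed.

(** The form maps V_d/W_d injectively into V_(d+1)/W_(d+1), so the quotient has there the dimension
    of the latter minus that of the former. The equation is written without subtraction. *)
Lemma mxrank_quot d :
  (\rank (mxquot d.+1) + \rank (W d) = \rank (W d.+1) + h d)%N.
Proof.
pose B := mxform d *m cokermx (W d.+1).
have kB : (kermx B == W d)%MS.
  apply/andP; split; apply/rV_subP => v.
    rewrite sub_kermx mulmxA -submxE; exact: form_inj.
  by move=> vW; rewrite sub_kermx mulmxA -submxE; exact: submx_form.
have kC : (kermx (cokermx (W d.+1)) == W d.+1)%MS.
  by apply/andP; split; apply/rV_subP => v; rewrite sub_kermx -submxE.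
have rB : (\rank B + \rank (W d) = h d)%N.
  rewrite -(eqmxP kB) mxrank_ker subnKC //; exact: rank_leq_row.
have := mxrank_mul_ker (mxform d) (cokermx (W d.+1)).
rewrite (cap_eqmx (eqmx_refl _) (eqmxP kC)) -/B.
have := mxrank_sum_cap (W d.+1) (mxform d); rewrite capmxC /=.
set x := \rank (_ + _); set y := \rank (_ :&: _).
by move=> e1 e2; lia.
Qed.

(** This is the long exact sequence of 0 -> V/W -> V/W -> V/(W + lV) -> 0, chased by hand: H^j of
    the quotient lies between H^j and H^(j+1) of V/W. *)
Lemma mxexact_quot r : mxexact X W r.+1 -> mxexact X mxquot r.
Proof.
move=> exX j lt_jr d c dcW.
have cob_form e s (b : seq 'I_m -> 'rV_(h e)) :
    cobord (mxact X e.+1) s (fun q => b q *m mxform e) =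
    cobord (mxact X e) s b *m mxform e.+1.
  rewrite -[RHS]/(mulmxr (mxform e.+1) _).
  rewrite (cobord_morph (x' := mxact X e.+1) (f := mulmxr (mxform e))) //.
  by move=> i v /=; rewrite -!mulmxA mxform_comm.
(* The connecting map: dc = l e modulo W. Since d d = 0 and l is injective, e is a cocycle, so e =
   db modulo W; then c - l b is a cocycle modulo W. *)
have /choice[e eP] s : exists v : 'rV_(h d.+1), size s = j.+1 ->
    (cobord (mxact X d.+1) s c - v *m mxform d.+1 <= W d.+2)%MS.
  case: (eqVneq (size s) j.+1) => [sz|/eqP ne_s]; last by exists 0.
  have /sub_addsmxP[[u v] /= ->] := dcW s sz.
  by exists v => _; rewrite addrK submxMl.
have [|s sz|b bP] := exX j.+1 _ d e; first by rewrite ltnS.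
  apply: form_inj; rewrite -cob_form.
  have := @submx_cobord _ _ _ _ _ Wstable d.+2 s
    (fun q => cobord (mxact X d.+1) q c - e q *m mxform d.+1).
  rewrite cobordB (cobord_cobord (x := mxact X d.+1)) => [H|i k v]; last first.
    by rewrite /= -!mulmxA Xcomm.
  have : (0 - cobord (mxact X d.+2) s (fun q => e q *m mxform d.+1) <= W d.+3)%MS.
    by apply: H => q sq; apply: eP; move: sq; rewrite sz => -[].
  by rewrite sub0r eqmx_opp.
have [|a aP] := exX j (ltnW lt_jr) d (fun s => c s - b s *m mxform d).
  move=> s sz; rewrite cobordB cob_form.
  rewrite -(subrK (e s *m mxform d.+1) (cobord _ _ _)) -addrA -mulmxBl.
  by rewrite addmx_sub ?eP // submx_form // bP.
exists a => s sz /=.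
rewrite -(subrK (b s *m mxform d) (c s)) addrAC addmx_sub //.
  by rewrite (submx_trans (aP s sz)) ?addsmxSl.
by rewrite (submx_trans _ (addsmxSr _ _)) // submxMl.
Qed.

End LinearForm.

(** * Base change to L(t) and the generic linear form *)

Section GenericForm.
Variables (L : fieldType) (m : nat) (h : nat -> nat).
Variable X : 'I_m -> forall d, 'M[L]_(h d, h d.+1).
Variable W : forall d, 'M[L]_(h d).
Local Notation P := {poly L}.
Local Notation F := {fraction {poly L}}.
Local Notation toF := (@tofrac {poly L}).
Local Notation iota := (toF \o polyC).
Local Notation Xp := (fun i d => map_mx polyC (X i d)).
Local Notation Xf := (fun i d => map_mx iota (X i d)).
Local Notation Wf := (fun d => map_mx iota (W d)).

Hypotheses (Xcomm : mxcommuting X) (Wstable : mxstable X W).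

Lemma mxcommuting_frac : mxcommuting Xf.
Proof. by move=> i j d; rewrite -!map_mxM Xcomm. Qed.

Lemma mxstable_frac : mxstable Xf Wf.
Proof. by move=> i d; rewrite -map_mxM map_submx. Qed.

Lemma map_tofrac_mulmx p q k (u : 'M[P]_(p, q)) (A : 'M[L]_(q, k)) :
  map_mx toF (u *m map_mx polyC A) = map_mx toF u *m map_mx iota A.
Proof. by rewrite map_mxM; congr (_ *m _); apply/matrixP => i j; rewrite !mxE. Qed.

(** A cochain of degree j has finitely many values, so its denominators can be cleared. Each
    coefficient in t is then a cocycle over L, and the primitives of the coefficients are assembled
    into one polynomial. *)
Lemma mxexact_frac r : mxexact X W r -> mxexact Xf Wf r.
Proof.
move=> exX j lt_jr d c dcW.
have [a [u [a0 au]]] := common_denominator (fun t : j.-tuple 'I_m => c t).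
pose u' s := if insub s is Some t then u t else 0.
have u'E s : size s = j -> map_mx toF (u' s) = a *: c s.
  move=> sz; rewrite /u'; case: insubP => [t _ <-|]; first by rewrite -au.
  by rewrite sz eqxx.
pose cp p s := map_mx (coefp p) (u' s).
have cob_coef e p s (v : seq 'I_m -> 'rV[P]_(h e)) :
    map_mx (coefp p) (cobord (mxact Xp e) s v) =
    cobord (mxact X e) s (fun q => map_mx (coefp p) (v q)).
  by apply: cobord_morph => i w; rewrite /= map_coefp_mulmx.
have cob_frac e s (v : seq 'I_m -> 'rV[P]_(h e)) :
    map_mx toF (cobord (mxact Xp e) s v) =
    cobord (mxact Xf e) s (fun q => map_mx toF (v q)).
  by apply: cobord_morph => i w; rewrite /= map_tofrac_mulmx.
have dcp p s : size s = j.+1 -> (cobord (mxact X d.+1) s (cp p) <= W d.+2)%MS.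
  move=> sz; rewrite -cob_coef; move: p; apply/submx_frac; rewrite cob_frac.
  rewrite (eq_cobord _ (c' := fun q => a *: c q)) => [|q sq]; last first.
    by apply: u'E; move: sq; rewrite sz => -[].
  rewrite -(cobord_morph (x := mxact Xf d.+1) (g := *:%R a)) => [|i v].
    by rewrite scalemx_sub // dcW.
  by rewrite /= scalemxAl.
have /choice[b bP] p := exX j lt_jr d (cp p) (dcp p).
pose T := \max_(t : j.-tuple 'I_m) \max_(k < h d.+1) size (u t 0%R k).
have uT p s : (T <= p)%N -> cp p s = 0.
  move=> le_Tp; apply/rowP => k; rewrite !mxE /u'.
  case: insubP => [t _ _|_]; last by rewrite mxE /= coef0.
  apply: nth_default; apply: leq_trans le_Tp.
  apply: leq_trans (leq_bigmax t).
  exact: (leq_bigmax k).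
(* The coefficients of [u'] vanish from T on. Their primitives can be replaced by 0 there, which
   makes [B] a polynomial. *)
pose B s : 'rV[P]_(h d) := \row_k \poly_(p < T) b p s 0 k.
exists (fun s => a^-1 *: map_mx toF (B s)) => s sz.
rewrite -(cobord_morph (x := mxact Xf d) (g := *:%R a^-1)) => [|i v]; last first.
  by rewrite /= scalemxAl.
rewrite -cob_frac -[c s](scalerK a0) -u'E // -scalerBr scalemx_sub //.
rewrite -map_mxB; apply/submx_frac => p; rewrite map_mxB cob_coef.
rewrite (eq_cobord _ (c' := fun q => if (p < T)%N then b p q else 0)) => [|q _].
  case: ltnP => [_|le_Tp]; first exact: bP.
  rewrite -/(cp p s) uT // sub0r eqmx_opp.
  by apply: submx_cobord => // q _; exact: sub0mx.
by apply/rowP => k; rewrite !mxE /= coef_poly; case: ifP; rewrite ?mxE.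
Qed.

Hypothesis socle : forall d (v : 'rV_(h d)),
  (forall i, (v *m X i d <= W d.+1)%MS) -> (v <= W d)%MS.

(** After clearing denominators, the coefficient of t^k in the product with the generic form is
    exactly the sum in [mccoy]. *)
Lemma mxform_frac_inj d (v : 'rV_(h d)) :
  (v *m mxform Xf (toF 'X) d <= Wf d.+1)%MS -> (v <= Wf d)%MS.
Proof.
move=> vW; have [a [u [a0 au]]] := common_denominator (fun _ : unit => v).
have {}au := au tt.
rewrite -[v](scalerK a0) scalemx_sub // au; apply/submx_frac.
have H := mccoy (T := \max_(k < h d) size (u tt 0%R k)) Xcomm Wstable socle.
apply: (H d (fun p => map_mx (coefp p) (u tt))) => [p le_p | k].
  suff -> : map_mx (coefp p) (u tt) = 0 by exact: sub0mx.
  apply/rowP => k; rewrite !mxE; apply: nth_default.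
  by apply: leq_trans le_p; exact: (leq_bigmax k).
have : (map_mx toF (\sum_(i < m) 'X^i *: (u tt *m map_mx polyC (X i d)))
        <= Wf d.+1)%MS.
  rewrite raddf_sum /= (eq_bigr (fun i : 'I_m => toF 'X ^+ i *: (a *: v *m Xf i d))).
    have -> : \sum_(i < m) toF 'X ^+ i *: (a *: v *m Xf i d) =
              a *: (v *m mxform Xf (toF 'X) d).
      rewrite mulmx_sumr scaler_sumr; apply: eq_bigr => i _.
      by rewrite -scalemxAl -scalemxAr !scalerA mulrC.
    exact: scalemx_sub.
  by move=> i _; rewrite map_mxZ rmorphXn /= map_tofrac_mulmx au.
move/submx_frac/(_ k); rewrite raddf_sum /=.
congr (_ <= _)%MS; apply: eq_bigr => i _.
have -> : map_mx (coefp k) ('X^i *: (u tt *m map_mx polyC (X i d))) =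
    if (i <= k)%N then map_mx (coefp (k - i)) (u tt *m map_mx polyC (X i d)) else 0.
  apply/rowP => l; rewrite mxE mxE /= coefXnM ltnNge.
  by case: (i <= k)%N; rewrite /= [RHS]mxE.
by case: ifP => _ //; rewrite map_coefp_mulmx.
Qed.

End GenericForm.

(* On coefficient sequences this is multiplication by 1 - t. *)
Definition bdiff (f : nat -> int) (d : nat) : int :=
  if d is e.+1 then f e.+1 - f e else f 0.

(** Each step extends scalars, divides by the generic form, loses one degree of vanishing, and by
    [mxrank_quot] replaces the Hilbert function by its difference. The field grows from L to L(t),
    so the induction runs over all fields at once. *)
Theorem mxexact_bdiff_ge0 (r : nat) (L : fieldType) (m : nat) (h : nat -> nat)
    (X : 'I_m -> forall d, 'M[L]_(h d, h d.+1)) (W : forall d, 'M[L]_(h d)) :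
  h 0 = 0%N -> mxcommuting X -> mxstable X W -> mxexact X W r ->
  forall d, 0 <= iter r bdiff (fun d => (h d)%:Z - (\rank (W d))%:Z) d.
Proof.
move=> h0; elim: r L X W => [|r IH] L X W Xcomm Wstable exX d.
  by rewrite subr_ge0 lez_nat rank_leq_row.
pose Xf i d := map_mx (@tofrac _ \o polyC) (X i d).
pose Wf d := map_mx (@tofrac _ \o polyC) (W d).
pose t := @tofrac {poly L} 'X.
have Xfcomm : mxcommuting Xf by exact: mxcommuting_frac.
have Wfstable : mxstable Xf Wf by exact: mxstable_frac.
have form_inj d' (v : 'rV_(h d')) :
    (v *m mxform Xf t d' <= Wf d'.+1)%MS -> (v <= Wf d')%MS.
  by apply: mxform_frac_inj => //; exact: mxexact_socle exX.
have exW : mxexact Xf (mxquot Xf Wf t) r.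
  by apply: mxexact_quot => //; exact: mxexact_frac.
have := IH _ _ _ Xfcomm (mxquot_stable t Xfcomm Wfstable) exW d.
rewrite iterSr; congr (0 <= iter r bdiff _ d); apply/funext => -[|e] /=.
  by rewrite mxrank_map.
have := mxrank_quot Wfstable form_inj e; rewrite !mxrank_map /=.
move: (\rank (_ + _)) (\rank (W e.+1)) (\rank (W e)) => x y z xyz.
by lia.
Qed.

(** * From regular sequences to vanishing cohomology *)

Section GradedDepth.
Variables (K : fieldType) (m : nat).
Local Notation S := {mpoly K[m]}.

Section RegularSequences.
Variable M : gmodule K m.

Lemma in_mulE (fs : seq S) (u : M) :
  in_mul fs u <-> exists c : nat -> M, u = \sum_(0 <= k < size fs) fs`_k *: c k.
Proof.
split=> -[c ->].
  exists (fun k => if insub k is Some i then c i else 0).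
  by rewrite big_mkord; apply: eq_bigr => i _; rewrite valK.
by exists (fun i => c i); rewrite big_mkord.
Qed.

Lemma in_mul0 (fs : seq S) : in_mul fs (0 : M).
Proof.
by exists (fun=> 0); rewrite big1 // => i _; rewrite scaler0.
Qed.

Lemma in_mulB (fs : seq S) (u v : M) :
  in_mul fs u -> in_mul fs v -> in_mul fs (u - v).
Proof.
move=> [c ->] [e ->]; exists (fun i => c i - e i).
by rewrite -sumrB; apply: eq_bigr => i _; rewrite scalerBr.
Qed.

Lemma in_mulD (fs : seq S) (u v : M) :
  in_mul fs u -> in_mul fs v -> in_mul fs (u + v).
Proof.
move=> uW vW; rewrite -[v]opprK; apply: in_mulB => //.
by rewrite -sub0r; apply: in_mulB => //; exact: in_mul0.
Qed.

Lemma in_mulZ (fs : seq S) a (u : M) : in_mul fs u -> in_mul fs (a *: u).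
Proof.
move=> [c ->]; exists (fun i => a *: c i).
by rewrite scaler_sumr; apply: eq_bigr => i _; rewrite !scalerA mulrC.
Qed.

Lemma in_mul_take i (fs : seq S) (u : M) : (i < size fs)%N ->
  in_mul (take i.+1 fs) u <-> exists v, in_mul (take i fs) (u - fs`_i *: v).
Proof.
move=> lt_i; have le_i := ltnW lt_i.
have sumE k (c : nat -> M) : (k <= size fs)%N ->
    \sum_(0 <= l < size (take k fs)) (take k fs)`_l *: c l =
    \sum_(0 <= l < k) fs`_l *: c l.
  move=> le_k; rewrite size_takel //; apply: eq_big_nat => l /andP[_ lt_l].
  by rewrite nth_take.
split.
  move/in_mulE => [c ->]; exists (c i); apply/in_mulE; exists c.
  by rewrite !sumE // big_nat_recr //= addrK.
move=> [v /in_mulE[c uE]]; apply/in_mulE.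
exists (fun k => if k == i then v else c k).
rewrite sumE // big_nat_recr //= eqxx -[u](subrK (fs`_i *: v)) uE sumE //.
congr (_ + _); apply: eq_big_nat => k /andP[_ lt_k].
by rewrite (ltn_eqF lt_k).
Qed.

Definition varact (k : 'I_m) : {additive M -> M} := *:%R ('X_k : S).

(* A combination of the x_k is null-homotopic on cochains, which plays the role
   of "the ideal (x_1, ..., x_m) annihilates Ext(K, M)". *)
Lemma regular_seq_exact (fs : seq S) :
  {subset fs <= max_ideal (K := K) (m := m)} -> regular_seq M fs ->
  forall j i, (i + j < size fs)%N -> forall c : seq 'I_m -> M,
  (forall s, size s = j.+1 -> in_mul (take i fs) (cobord varact s c)) ->
  exists b : seq 'I_m -> M,
    forall s, size s = j -> in_mul (take i fs) (c s - cobord varact s b).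
Proof.
move=> fs_max [fs_reg _]; elim=> [|j IH] i lt_ij c dcW.
  exists (fun=> 0) => s /size0nil -> /=; rewrite subr0.
  rewrite addn0 in lt_ij; apply: fs_reg => //.
  have /asboolP[a ->] : fs`_i \in max_ideal (K := K) (m := m).
    by apply: fs_max; exact: mem_nth.
  rewrite scaler_suml; apply: big_ind => [||k _]; [exact: in_mul0|exact: in_mulD|].
  rewrite -scalerA; apply: in_mulZ.
  by have := dcW [:: k] erefl; rewrite /= subr0.
have lt_i : (i < size fs)%N by rewrite (leq_trans _ lt_ij) // ltnS leq_addr.
have /asboolP[a fE] : fs`_i \in max_ideal (K := K) (m := m).
  by apply: fs_max; exact: mem_nth.
(* Contraction along f_i = sum_k a_k x_k: for the cocycle c it gives db = f_i c modulo the earlier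
   f's, so b is a cocycle modulo one more element. *)
pose b q := \sum_k a k *: c (k :: q).
have cob_b s : cobord varact s b =
    \sum_k a k *: cobord varact s (fun q => c (k :: q)).
  rewrite cobord_sum; apply: eq_bigr => k _.
  rewrite -[RHS]/(( *:%R (a k) : {additive M -> M}) _).
  symmetry; apply: cobord_morph => k' v /=.
  by rewrite !scalerA mulrC.
have fc s : size s = j.+1 ->
    in_mul (take i fs) (fs`_i *: c s - cobord varact s b).
  move=> sz; rewrite fE scaler_suml cob_b -sumrB.
  apply: big_ind => [||k _]; [exact: in_mul0|exact: in_mulD|].
  rewrite -scalerA -scalerBr; apply: in_mulZ.
  by apply: (dcW (k :: s)); rewrite /= sz.
have [|s sz|e eP] := IH i.+1 _ b; first by rewrite addSnnS.
  apply/in_mul_take => //; exists (c s).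
  by rewrite -opprB -sub0r; apply: in_mulB; [exact: in_mul0|exact: fc].
(* Now b = de + f_i v modulo the earlier f's, whence f_i c = db = f_i dv, and f_i can be cancelled:
   v is the primitive of c. *)
have /choice[v vP] q : exists v, size q = j ->
    in_mul (take i fs) (b q - cobord varact q e - fs`_i *: v).
  case: (eqVneq (size q) j) => [sq|/eqP ne]; last by exists 0.
  by have /in_mul_take[//|v] := eP q sq; exists v.
exists v => s sz; apply: fs_reg => //.
rewrite scalerBr -(subrKA (cobord varact s b)).
apply: in_mulD; first exact: fc.
have := @cobord_closed _ _ _ varact (in_mul (take i fs)) s
  (fun q => b q - cobord varact q e - fs`_i *: v q) (in_mul0 _) (@in_mulB _).
rewrite !cobordB cobord_cobord ?subr0 => [|k l u]; last first.
  by rewrite /= !scalerA mulrC.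
rewrite -(cobord_morph (x := varact) (g := *:%R (fs`_i))) => [|k u]; last first.
  by rewrite /= !scalerA mulrC.
apply=> k q sq; apply: in_mulZ; apply: vP.
by move: sq; rewrite sz => -[].
Qed.

End RegularSequences.

Section Components.
Variable M : gmodule K m.

Lemma gcompD d (u v : M) : gcomp d u -> gcomp d v -> gcomp d (u + v).
Proof.
move=> du dv; rewrite -[v]opprK; apply: gcompB => //.
by rewrite -sub0r; apply: gcompB => //; exact: gcomp0.
Qed.

Lemma gcompC d (a : K) (u : M) : gcomp d u -> gcomp d (a%:MP *: u).
Proof.
move=> du; rewrite -[d]add0r; apply: (gcompZ (e := 0%N)) => //.
by rewrite -[a%:MP]mulr1 mul_mpolyC rpredZ // dhomog1.
Qed.

Lemma gcompX d k (u : M) : gcomp d u -> gcomp (1 + d) (('X_k : S) *: u).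
Proof. by move=> du; apply: (gcompZ (e := 1%N)) => //; rewrite dhomogX /= mdeg1. Qed.

Lemma big_supp (r r' : seq int) (a : int -> M) :
  uniq r -> uniq r' -> {subset r <= r'} -> (forall d, d \notin r -> a d = 0) ->
  \sum_(d <- r) a d = \sum_(d <- r') a d.
Proof.
move=> ur ur' sub a0; rewrite [RHS](bigID (mem r)) /= [X in _ + X]big1 // addr0.
rewrite -[RHS]big_filter; apply: perm_big; apply: uniq_perm => //.
  exact: filter_uniq.
by move=> d; rewrite mem_filter; case: (boolP (d \in r)) => [/sub|] //= ->.
Qed.

(** The projections onto the homogeneous components. Additivity and compatibility with the variables
    both follow from the uniqueness [p_uniq] of the decomposition. *)
Lemma gproj_exists : exists pi : int -> {additive M -> M},
  [/\ forall d u, gcomp d (pi d u), forall d u, gcomp d u -> pi d u = u,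
      forall d k u, pi (1 + d) (('X_k : S) *: u) = ('X_k : S) *: pi d u &
      forall u, exists r : seq int, forall r', uniq r' -> {subset r <= r'} ->
        u = \sum_(d <- r') pi d u].
Proof.
have /choice[r /choice[c cP]] := @gcomp_span _ _ M.
(* The spanning list may repeat a degree, hence the multiplicity. *)
pose p d u := c u d *+ count_mem d (r u).
have pc d u : gcomp d (p d u).
  by rewrite /p; elim: (count_mem _ _) => [|k IH];
    [exact: gcomp0 | rewrite mulrS; apply: gcompD => //; case: (cP u)].
have p0 d u : d \notin undup (r u) -> p d u = 0.
  by rewrite mem_undup => /count_memPn; rewrite /p => ->.
have pE u : u = \sum_(d <- undup (r u)) p d u.
  by rewrite big_undup_iterop_count; case: (cP u).
have p_uniq u (s : seq int) (a : int -> M) : uniq s -> (forall d, gcomp d (a d)) ->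
    (forall d, d \notin s -> a d = 0) -> u = \sum_(d <- s) a d ->
    forall d, p d u = a d.
  move=> us ac a0 uE d; pose t := undup (d :: s ++ undup (r u)).
  have ut : uniq t by exact: undup_uniq.
  apply/eqP; rewrite -subr_eq0; apply/eqP.
  apply: (gcomp_free (c := fun d => p d u - a d) ut).
  - by move=> e; apply: gcompB.
  - rewrite sumrB -(big_supp (r := undup (r u)) _ ut) ?undup_uniq //.
    + rewrite -(big_supp us ut) -?pE -?uE ?subrr // => e es.
      by rewrite mem_undup inE mem_cat es orbT.
    + by move=> e es; rewrite mem_undup inE mem_cat es !orbT.
    + by move=> e; exact: p0.
  - by rewrite mem_undup inE eqxx.
have pB d : zmod_morphism (p d).
  move=> u v; pose t := undup (undup (r u) ++ undup (r v)).
  apply: (p_uniq _ t (fun d => p d u - p d v)) => [|e|e|].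
  - exact: undup_uniq.
  - exact: gcompB.
  - rewrite mem_undup mem_cat negb_or => /andP[eu ev].
    by rewrite !p0 // subrr.
  - have tE w : {subset undup (r w) <= t} -> w = \sum_(d <- t) p d w.
      move=> sub; rewrite {1}[w]pE; apply: big_supp => //; rewrite ?undup_uniq //.
      by move=> e; exact: p0.
    by rewrite sumrB -!tE // => e es; rewrite mem_undup mem_cat es ?orbT.
pose pB_mixin d := GRing.isZmodMorphism.Build M M (p d) (pB d).
pose pi d : {additive M -> M} := HB.pack (p d) (pB_mixin d).
exists pi; split=> [|d u du|d k u|u]; first exact: pc.
  transitivity (if d == d then u else 0); last by rewrite eqxx.
  apply: (p_uniq u [:: d] (fun e => if e == d then u else 0)) => // [e|e|].
  - by case: eqP => [->|_] //; exact: gcomp0.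
  - by rewrite inE => /negPf ->.
  - by rewrite big_seq1 eqxx.
{ pose s := [seq 1 + e | e <- undup (r u)].
pose a e := ('X_k : S) *: p (e - 1) u.
transitivity (a (1 + d)); last by rewrite /a addrAC subrr add0r.
apply: (p_uniq _ s) => [|e|e|].
- by rewrite map_inj_uniq ?undup_uniq //; exact: addrI.
- by rewrite -[e](subrK 1) [_ + 1]addrC /a addrAC subrr add0r; exact: gcompX.
- move=> es; rewrite /a p0 ?scaler0 //; apply: contra es => es.
  by apply/mapP; exists (e - 1) => //; rewrite addrC subrK.
- rewrite big_map {1}[u]pE scaler_sumr; apply: eq_bigr => e _.
  by rewrite /a addrAC subrr add0r.
}
exists (undup (r u)) => t ut sub; rewrite {1}[u]pE.
by apply: big_supp => //; rewrite ?undup_uniq // => e; exact: p0.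
Qed.

Variable h : nat -> nat.
Hypothesis h_dim : forall d : nat, comp_dim M (d%:Z - 1) (h d).

(** Bases of the components turn the variables into matrices. Index d stands for degree d - 1, in
    accordance with the shift in [mxexact]. *)
Lemma gmodule_matrices : exists (X : 'I_m -> forall d, 'M[K]_(h d, h d.+1))
    (toM : forall d, {additive 'rV[K]_(h d) -> M}),
  [/\ forall d, injective (toM d), forall d u, gcomp (d%:Z - 1) u ->
        exists v, toM d v = u, forall d v, gcomp (d%:Z - 1) (toM d v) &
      forall d k v, toM d.+1 (v *m X k d) = ('X_k : S) *: toM d v].
Proof.
pose b d := sval (cid (h_dim d)); have bP d := svalP (cid (h_dim d)).
rewrite -/(b _) in bP.
pose t d (v : 'rV[K]_(h d)) := \sum_i (v 0 i)%:MP *: b d i.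
have tB d : zmod_morphism (t d).
  move=> u v; rewrite /t -sumrB; apply: eq_bigr => i _.
  by rewrite !mxE mpolyCB scalerBl.
have tZ d a v : t d (a *: v) = a%:MP *: t d v.
  rewrite /t scaler_sumr; apply: eq_bigr => i _.
  by rewrite !mxE mpolyCM scalerA.
pose tmix d := GRing.isZmodMorphism.Build _ _ (t d) (tB d).
pose T d : {additive 'rV[K]_(h d) -> M} := HB.pack (t d) (tmix d).
have tc d v : gcomp (d%:Z - 1) (t d v).
  apply: (big_ind (@gcomp _ _ M (d%:Z - 1))) => [||i _]; [exact: gcomp0|exact: gcompD|].
  by apply: gcompC; have [bc _] := bP d; exact: bc.
have t_inj d : injective (t d).
  move=> u v uv; have [_ /(_ _ (tc d u))[w [_ wP]]] := bP d.
  by rewrite -(wP u erefl); apply: wP; rewrite -/(t d v) -uv.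
have t_surj d u : gcomp (d%:Z - 1) u -> exists v, t d v = u.
  by move=> du; have [_ /(_ _ du)[w [-> _]]] := bP d; exists w.
have degS (d : nat) : 1 + (d%:Z - 1) = d.+1%:Z - 1 by lia.
have x_ex (k : 'I_m) (d : nat) : exists x : 'I_(h d) -> 'rV[K]_(h d.+1),
    forall i, t d.+1 (x i) = ('X_k : S) *: b d i.
  have /choice[x xE] : forall i : 'I_(h d), exists v, t d.+1 v = ('X_k : S) *: b d i.
    move=> i; apply: t_surj; rewrite -degS; apply: gcompX.
    by have [bc _] := bP d; exact: bc.
  by exists x.
pose x k d := sval (cid (x_ex k d)); have xP k d := svalP (cid (x_ex k d)).
exists (fun k d => \matrix_i x k d i), T; split=> //= d k v.
rewrite mulmx_sum_row -[LHS]/(T d.+1 _) raddf_sum /= [in RHS]/t scaler_sumr.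
apply: eq_bigr => i _; by rewrite tZ rowK xP !scalerA mulrC.
Qed.

End Components.
(** The exactness of M itself, the case of no f's divided out in [regular_seq_exact], is transported
    to the matrices with W = 0. *)
Theorem regular_seq_bdiff_ge0 (M : gmodule K m) (h : nat -> nat) (fs : seq S) :
  (forall d : nat, comp_dim M (d%:Z - 1) (h d)) -> h 0 = 0%N ->
  {subset fs <= max_ideal (K := K) (m := m)} -> regular_seq M fs ->
  forall r d, (r <= size fs)%N -> 0 <= iter r bdiff (fun d => (h d)%:Z) d.
Proof.
move=> h_dim h0 fs_max fs_reg r d le_r.
have [X [T [T_inj T_surj Tc TX]]] := gmodule_matrices h_dim.
have [pi [pi_c pi_id piX _]] := gproj_exists M.
have degS (e : nat) : 1 + (e%:Z - 1) = e.+1%:Z - 1 by lia.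
pose W e : 'M[K]_(h e) := 0.
have in_mul_nil u : in_mul (take 0 fs) (u : M) <-> u = 0.
  by rewrite take0; split=> [[c ->] | ->]; [rewrite big_ord0 | exact: in_mul0].
have T_cob e s (c : seq 'I_m -> 'rV[K]_(h e)) :
    T e.+1 (cobord (mxact X e) s c) = cobord (varact M) s (fun q => T e (c q)).
  by apply: cobord_morph => i v; rewrite /= TX.
have Xcomm : mxcommuting X.
  move=> i j e; apply/row_matrixP => k; rewrite !rowE !mulmxA; apply: T_inj.
  by rewrite !TX !scalerA mulrC.
have Wstable : mxstable X W by move=> i e; rewrite mul0mx sub0mx.
suff exX : mxexact X W r.
  have := mxexact_bdiff_ge0 h0 Xcomm Wstable exX d.
  by congr (0 <= iter r bdiff _ d); apply/funext => e; rewrite mxrank0 subr0.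
move=> j lt_jr e c dc0.
have [|s sz|b bP] := @regular_seq_exact M fs fs_max fs_reg j 0
    _ (fun s => T e.+1 (c s)).
- exact: leq_trans le_r.
- by apply/in_mul_nil; rewrite -T_cob; have := dc0 s sz;
    rewrite submx0 => /eqP ->; rewrite raddf0.
(* The primitive in M need not be homogeneous. Its component of degree e - 1 is again a primitive,
   because the projections commute with the variables. *)
have /choice[b' b'P] q : exists v, T e v = pi (e%:Z - 1) (b q).
  by apply: T_surj; exact: pi_c.
exists b' => s sz; rewrite submx0 subr_eq0; apply/eqP; apply: T_inj.
rewrite T_cob; have /in_mul_nil/eqP := bP s sz; rewrite subr_eq0 => /eqP TE.
rewrite -[LHS](pi_id (e.+1%:Z - 1)); last exact: Tc.
rewrite TE -degS.
rewrite (cobord_morph (x' := varact M) (f := pi (e%:Z - 1))) => [|i v]; last first.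
  by rewrite /= piX.
by apply: eq_cobord => q _; rewrite b'P.
Qed.

End GradedDepth.

Lemma comp_dim_uniq (K : fieldType) (m : nat) (M : gmodule K m) d k k' :
  comp_dim M d k -> comp_dim M d k' -> k = k'.
Proof.
wlog suff le : k k' / comp_dim M d k -> comp_dim M d k' -> (k' <= k)%N.
  by move=> dk dk'; apply/eqP; rewrite eqn_leq !le.
move=> [b [bc b_coord]] [b' [b'c b'_coord]].
have /choice[a aP] j : exists v : 'rV_k, b' j = \sum_i (v 0 i)%:MP *: b i.
  by have [v [vE _]] := b_coord _ (b'c j); exists v.
pose A := \matrix_j a j.
have AE (v : 'rV_k') :
    \sum_j (v 0 j)%:MP *: b' j = \sum_i ((v *m A) 0 i)%:MP *: b i.
  under eq_bigr => j _ do rewrite aP scaler_sumr.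
  rewrite exchange_big /=; apply: eq_bigr => i _.
  rewrite mxE raddf_sum scaler_suml; apply: eq_bigr => j _.
  by rewrite /= !mxE scalerA mpolyCM.
suff fA : row_free A by rewrite -(eqP fA) rank_leq_col.
rewrite -kermx_eq0 -submx0; apply/rV_subP => v; rewrite sub_kermx => /eqP vA.
have [w [_ wP]] := b'_coord 0 (gcomp0 M d).
rewrite submx0 -(wP v) ?(wP 0) //.
  by rewrite big1 // => j _; rewrite mxE mpolyC0 scale0r.
by rewrite AE vA big1 // => j _; rewrite mxE mpolyC0 scale0r.
Qed.

(** * Hilbert functions of quotients by monomial ideals *)

Section MonomialQuotient.
Local Open Scope quotient_scope.
Variables (K : fieldType) (m : nat) (I : finType) (mon : I -> 'X_{1..m}).
Variables (g : I -> {mpoly K[m]}) (e : I -> nat).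
Variable g_homog : forall i, g i \is (e i).-homog.
Hypothesis gE : forall i, g i = 'X_[mon i].
Local Notation S := {mpoly K[m]}.
Local Notation Q := (quot_gmodule g_homog).
Local Notation pi := (\pi_({ideal_quot (in_ideal g)})).

Definition standard (u : 'X_{1..m}) : bool := ~~ [exists i, (mon i <= u)%MM].

Lemma in_monomial_ideal (p : S) :
  (p \in in_ideal g) = all (fun u => ~~ standard u) (msupp p).
Proof.
apply/idP/allP => [/asboolP[c ->] u|p_div].
  move/msupp_sum_le => /flattenP[s /mapP[i _ ->]].
  rewrite gE (perm_mem (msuppMX _ _)) => /mapP[v _ ->].
  by rewrite negbK; apply/existsP; exists i; exact: lem_addr.
rewrite [p]mpolyE big_seq rpred_sum // => u /p_div.
rewrite negbK => /existsP[i le_iu].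
rewrite -mul_mpolyC; apply: in_idealM; rewrite -(submK le_iu) mpolyXD -gE.
apply: in_idealM; apply/asboolP; exists (fun j => (j == i)%:R).
rewrite (bigD1 i) //= eqxx mul1r big1 ?addr0 // => j /negPf ->.
by rewrite mul0r.
Qed.

Lemma quot_pi_eq0 (p : S) : (pi p = 0 :> Q) <-> p \in in_ideal g.
Proof.
rewrite -[X in X \in _]subr0 Quotient.idealrBE.
rewrite (_ : pi 0 = 0); last exact: raddf0.
by split=> [->|/eqP].
Qed.

Lemma comp_dim_monomial_quotient (d : nat) (bs : seq 'X_{1..m}) :
  uniq bs -> (forall u, (u \in bs) = (mdeg u == d) && standard u) ->
  comp_dim Q d (size bs).
Proof.
move=> ubs bsE; pose b (i : 'I_(size bs)) : S := 'X_[nth 0%MM bs i].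
have bi (i : 'I_(size bs)) : nth 0%MM bs i \in bs by rewrite mem_nth.
have piE (c : 'rV[K]_(size bs)) :
    \sum_i (c 0 i)%:MP *: (pi (b i) : Q) = pi (\sum_i c 0 i *: b i) :> Q.
  rewrite raddf_sum; apply: eq_bigr => i _.
  by rewrite -mul_mpolyC; exact: quot_scale_pi.
have coefb (c : 'rV[K]_(size bs)) (i : 'I_(size bs)) :
    (\sum_i c 0 i *: b i)@_(nth 0%MM bs i) = c 0 i.
  rewrite raddf_sum (bigD1 i) //= mcoeffZ mcoeffX eqxx mulr1.
  rewrite big1 ?addr0 // => j ne_ji; rewrite mcoeffZ mcoeffX.
  by rewrite nth_uniq // (inj_eq val_inj) (negPf ne_ji) mulr0.
have coef0 (c : 'rV[K]_(size bs)) u : u \notin bs ->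
    (\sum_i c 0 i *: b i)@_u = 0.
  move=> ubs'; rewrite raddf_sum big1 //= => i _; rewrite mcoeffZ mcoeffX.
  case: eqP => [E|_]; last by rewrite mulr0.
  by rewrite -E bi in ubs'.
exists (fun i => pi (b i)); split=> [i|_ [p p_homog ->]].
  exists (b i) => //=; rewrite dhomogX.
  by have := bi i; rewrite bsE => /andP[].
pose c : 'rV[K]_(size bs) := \row_i p@_(nth 0%MM bs i).
exists c; split.
  rewrite piE; apply/eqP; rewrite -Quotient.idealrBE in_monomial_ideal.
  apply/allP => u; apply: contraL => u_std; rewrite -mcoeff_eq0 mcoeffB.
  have [u_bs|u_bs] := boolP (u \in bs).
    have lt_u : (index u bs < size bs)%N by rewrite index_mem.
    have := coefb c (Ordinal lt_u); rewrite /= nth_index // => ->.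
    by rewrite mxE /= nth_index // subrr.
  rewrite coef0 // subr0; move: u_bs; rewrite bsE u_std andbT => ne_d.
  by apply/eqP; apply: (dhomog_nemf_coeff p_homog).
move=> c'; rewrite piE => /eqP; rewrite -Quotient.idealrBE in_monomial_ideal.
move=> /allP p_div; apply/rowP => i; rewrite mxE; apply/eqP.
rewrite -subr_eq0 -[X in _ - X](coefb c' i) -mcoeffB mcoeff_eq0.
apply/negP => /p_div; apply/negP; rewrite negbK.
by have := bi i; rewrite bsE => /andP[].
Qed.

Lemma comp_dim_quotient_neg (d : nat) : comp_dim Q (Negz d) 0.
Proof.
exists (fun _ => 0); split=> [[]//|_ [p /eqP -> ->]].
exists 0; split=> [|c _]; last by rewrite [RHS]thinmx0.
by rewrite big_ord0; exact: raddf0.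
Qed.

Lemma fin_gen_quotient : fin_gen Q.
Proof.
exists 1%N, (fun _ => pi 1) => u; exists (fun _ => repr u).
by rewrite big_ord1 -[LHS]quot_reprK -[X in pi X]mulr1 -quot_scale_pi.
Qed.

End MonomialQuotient.

(** The number of monomials of degree d in s variables. With the truncated predecessor this holds
    for s = 0 too, where it is 1 for d = 0 and 0 otherwise. *)
Definition nmon (s d : nat) : nat := 'C((s + d).-1, d).

Section Monomials.
Variables (s m : nat) (f : 'I_s -> 'I_m).

Definition mnm_embed (u : 'X_{1..s}) : 'X_{1..m} :=
  [multinom (\sum_(i | f i == j) u i)%N | j < m].

Hypothesis f_inj : injective f.

Lemma mnm_embedE u i : mnm_embed u (f i) = u i.
Proof. by rewrite mnmE (big_pred1 i) // => j; rewrite (inj_eq f_inj). Qed.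

Lemma mnm_embed_out u j : (forall i, f i != j) -> mnm_embed u j = 0%N.
Proof. by move=> fj; rewrite mnmE big1 // => i; rewrite (negPf (fj i)). Qed.

Lemma mdeg_embed u : mdeg (mnm_embed u) = mdeg u.
Proof.
rewrite !mdegE; under eq_bigr do rewrite mnmE.
rewrite (exchange_big_dep predT) //=; apply: eq_bigr => i _.
by rewrite (eq_bigl (fun j => j == f i)) ?big_pred1_eq // => j; rewrite eq_sym.
Qed.

Lemma mnm_embed_inj : injective mnm_embed.
Proof. by move=> u v uv; apply/mnmP => i; rewrite -!mnm_embedE uv. Qed.

Definition embedded_mons (d : nat) : seq 'X_{1..m} :=
  [seq mnm_embed u | u <- [seq s2m (val t) | t <- enum (basis s d)]].

Lemma uniq_embedded_mons d : uniq (embedded_mons d).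
Proof. by rewrite (map_inj_uniq mnm_embed_inj) uniq_basis. Qed.

Lemma mem_embedded_mons d u : (u \in embedded_mons d) =
  (mdeg u == d) && [forall j, (j \in codom f) || (u j == 0%N)].
Proof.
apply/mapP/andP => [[v]|[/eqP ud /forallP u0]].
  rewrite -basis_cover => /eqP vd ->; rewrite mdeg_embed vd; split=> //.
  apply/forallP => j; case: (boolP (j \in codom f)) => //= fj.
  apply/eqP/mnm_embed_out => i; apply: contra fj => /eqP <-.
  exact: codom_f.
have vE : mnm_embed [multinom u (f i) | i < s] = u.
  apply/mnmP => j; have [/codomP[i ->]|fj] := boolP (j \in codom f).
    by rewrite mnm_embedE mnmE.
  rewrite mnm_embed_out => [|i].
    by have := u0 j; rewrite (negPf fj) => /eqP.
  by apply: contra fj => /eqP <-; exact: codom_f.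
exists [multinom u (f i) | i < s]; last by rewrite vE.
by rewrite -basis_cover -mdeg_embed vE ud.
Qed.

Lemma size_embedded_mons d : size (embedded_mons d) = nmon s d.
Proof.
rewrite /embedded_mons size_map /nmon; case: (posnP s) => [s0|s_gt0].
  clear f f_inj; move: s s0 => t ->.
  set bs := [seq _ | _ <- _].
  have bsE (u : 'X_{1..0}) : (u \in bs) = (d == 0%N).
    by rewrite -basis_cover mdegE big_ord0 eq_sym.
  have /perm_size -> : perm_eq bs (if d == 0%N then [:: 0%MM] else [::]).
    apply: uniq_perm; rewrite ?uniq_basis //; first by case: ifP.
    move=> u; rewrite bsE; case: ifP => // _; rewrite inE.
    by symmetry; apply/eqP/mnmP => -[].
  by case: d {bs bsE} => [|d] //=; rewrite bin_small.
by case: s f f_inj s_gt0 => // t _ _ _; rewrite size_basis addSn /= addnC.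
Qed.

End Monomials.

Lemma nmon0 s : nmon s 0 = 1%N.
Proof. exact: bin0. Qed.

Lemma nmonS s d : nmon s.+1 d.+1 = (nmon s.+1 d + nmon s d.+1)%N.
Proof. by rewrite /nmon !addSn !addnS /= binS addnC. Qed.

Lemma nmon0S d : nmon 0 d.+1 = 0%N.
Proof. by rewrite /nmon bin_small. Qed.

Section VariableQuotients.
Variables (K : fieldType) (m : nat) (J : pred 'I_m).
Local Open Scope quotient_scope.
Local Notation S := {mpoly K[m]}.

Definition vargen (j : {j | J j}) : S := 'X_(val j).

Lemma vargen_homog j : vargen j \is 1.-homog.
Proof. by rewrite dhomogX /= mdeg1. Qed.

Definition varquot : gmodule K m := quot_gmodule vargen_homog.
Local Notation pi := (\pi_({ideal_quot (in_ideal vargen)})).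

Lemma varquot_standard u :
  standard (fun j : {j | J j} => U_(val j)%MM) u = [forall j, J j ==> (u j == 0%N)].
Proof.
rewrite /standard negb_exists; apply/forallP/forallP => /= u0 j.
  apply/implyP => Jj; have := u0 (exist _ j Jj); rewrite /=.
  by rewrite lep1mP negbK.
by rewrite lep1mP negbK; have /implyP := u0 (val j); apply; exact: valP.
Qed.

(** The preimage in S of this submodule is the ideal of the variables in [js] and [J], so membership
    is tested monomial by monomial; regularity of any other variable can be read off. *)
Lemma in_mul_varquot (js : seq 'I_m) (p : S) :
  in_mul [seq 'X_j | j <- js] (pi p : varquot) <->
  forall u, u \in msupp p -> exists2 j, (j \in js) || J j & (0 < u j)%N.
Proof.
split.
  move=> [c]; pose q := \sum_(i < size [seq 'X_j | j <- js])
    [seq 'X_j : S | j <- js]`_i * repr (c i).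
  have -> : \sum_(i < size [seq 'X_j : S | j <- js])
      [seq 'X_j : S | j <- js]`_i *: (c i : varquot) = pi q.
    rewrite /q raddf_sum; apply: eq_bigr => i _.
    by rewrite -[c i in LHS]quot_reprK; exact: quot_scale_pi.
  move/eqP; rewrite -Quotient.idealrBE.
  rewrite (in_monomial_ideal (mon := fun j : {j | J j} => U_(val j)%MM)) //.
  move=> /allP pq u up; have [uq|uq] := boolP (u \in msupp q).
    move/msupp_sum_le: uq => /flattenP[t /mapP[i _ ->]].
    have lt_i : (i < size js)%N by rewrite -(size_map (fun j => 'X_j : S) js).
    have /hasP[j0 _ _] : has predT js by rewrite has_predT (leq_ltn_trans _ lt_i).
    rewrite (nth_map j0) // mulrC (perm_mem (msuppMX _ _)) => /mapP[v _ ->].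
    exists (nth j0 js i); first by rewrite mem_nth.
    by rewrite mnmDE mnm1E eqxx.
  have : u \in msupp (p - q).
    by rewrite mcoeff_msupp mcoeffB (memN_msupp_eq0 uq) subr0 -mcoeff_msupp.
  move/pq; rewrite varquot_standard negb_forall => /existsP[j].
  by rewrite negb_imply => /andP[Jj u0]; exists j; rewrite ?Jj ?orbT // lt0n.
move=> p_div; rewrite {1}[p]mpolyE raddf_sum big_seq.
apply: (big_ind (@in_mul _ _ varquot _)) => [||u /p_div[j Jj u_j]].
- exact: in_mul0.
- exact: in_mulD.
have uE : 'X_[u] = 'X_j * 'X_[u - U_(j)] :> S.
  by rewrite -mpolyXD addmC submK // lep1mP -lt0n.
change (in_mul [seq 'X_j | j <- js] (pi (p@_u *: 'X_[u]) : varquot)).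
case/orP: Jj => [js_j|Jj].
  have -> : pi (p@_u *: 'X_[u]) =
      (p@_u *: 'X_[u - U_(j)]) *: (('X_j : S) *: (pi 1 : varquot)) :> varquot.
    rewrite scalerA -[RHS]/(quot_scale _ _) quot_scale_pi mulr1.
    by rewrite uE -scalerAl mulrC.
  apply: in_mulZ; apply/in_mulE.
  exists (fun k => if k == index j js then pi 1 else 0).
  have lt_j : (index j js < size js)%N by rewrite index_mem.
  rewrite size_map big_mkord (bigD1 (Ordinal lt_j)) //= eqxx big1 ?addr0.
    by rewrite (nth_map j) // nth_index.
  move=> i; rewrite -val_eqE /= => /negPf ->; exact: scaler0.
rewrite (_ : pi _ = 0); first exact: in_mul0.
apply/(quot_pi_eq0 vargen_homog).
rewrite -mul_mpolyC; apply: in_idealM; rewrite uE mulrC; apply: in_idealM.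
apply/asboolP; exists (fun i => (i == exist _ j Jj)%:R).
rewrite (bigD1 (exist _ j Jj)) //= eqxx mul1r big1 ?addr0 // => i /negPf ->.
by rewrite mul0r.
Qed.

Lemma varquot_regular (js : seq 'I_m) (i : 'I_m) (v : varquot) :
  i \notin js -> ~~ J i -> in_mul [seq 'X_j | j <- js] (('X_i : S) *: v) ->
  in_mul [seq 'X_j | j <- js] v.
Proof.
move=> js_i J_i; have -> : v = pi (repr v) by rewrite quot_reprK.
rewrite -[_ *: _]/(quot_scale _ _) quot_scale_pi mulrC.
move/in_mul_varquot => Xv; apply/in_mul_varquot => u uv.
have [|j Jj uj] := Xv (U_(i) + u)%MM.
  by rewrite (perm_mem (msuppMX _ _)); apply/mapP; exists u.
exists j => //; move: uj; rewrite mnmDE mnm1E; case: eqP => // ij.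
by rewrite -ij (negPf js_i) (negPf J_i) in Jj.
Qed.

Lemma comp_dim_varquot s (f : 'I_s -> 'I_m) d : injective f ->
  (forall j, (j \in codom f) = ~~ J j) -> comp_dim varquot d%:Z (nmon s d).
Proof.
move=> f_inj fJ; rewrite -(size_embedded_mons f_inj).
apply: (comp_dim_monomial_quotient (mon := fun j : {j | J j} => U_(val j)%MM)) => //.
  exact: uniq_embedded_mons.
move=> u; rewrite mem_embedded_mons // varquot_standard.
by congr (_ && _); apply: eq_forallb => j; rewrite fJ implybE.
Qed.

End VariableQuotients.

Lemma Igen_mon (K : fieldType) (n : nat) (ij : 'I_n * 'I_n) :
  Igen K ij = 'X_[U_(lshift n ij.1) + U_(rshift n ij.2)].
Proof. by rewrite mpolyXD. Qed.

(** Some x_i y_j divides a monomial exactly when both kinds of variables occur in it. *)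
Lemma Igen_standard n (u : 'X_{1..n + n}) :
  standard (fun ij => U_(lshift n ij.1) + U_(rshift n ij.2))%MM u =
  [forall j, (j \in codom (@lshift n n)) || (u j == 0%N)] ||
  [forall j, (j \in codom (@rshift n n)) || (u j == 0%N)].
Proof.
have codom_l (i : 'I_n) : (lshift n i \in codom (@rshift n n)) = false.
  by apply/negP => /codomP[j /eqP]; rewrite eq_lrshift.
have codom_r (i : 'I_n) : (rshift n i \in codom (@lshift n n)) = false.
  by apply/negP => /codomP[j /eqP]; rewrite eq_rlshift.
apply/negP/orP => [u_std | u0 /existsP[[i j] /mnm_lepP le_u]]; last first.
  have le_i := le_u (lshift n i); have le_j := le_u (rshift n j).
  rewrite !mnmDE !mnm1E /= !eqxx in le_i le_j.
  case: u0 => /forallP u0; [have := u0 (rshift n j) | have := u0 (lshift n i)].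
    by rewrite codom_r => /= /eqP uj; rewrite uj addn1 in le_j.
  by rewrite codom_l => /= /eqP ui; rewrite ui add1n in le_i.
apply/orP; rewrite -[_ || _]negbK negb_or; apply/negP => /andP[].
rewrite !negb_forall => /existsP[j uj] /existsP[i ui]; apply: u_std.
move: uj ui; rewrite !negb_or => /andP[fj uj] /andP[fi ui].
case: (split_ordP j) => j' jE; first by rewrite jE codom_f in fj.
case: (split_ordP i) => i' iE; last by rewrite iE codom_f in fi.
apply/existsP; exists (i', j'); apply/mnm_lepP => k /=.
rewrite mnmDE !mnm1E -jE -iE; case: eqP => [<-|_].
  rewrite jE iE eq_rlshift addn0 -iE lt0n; exact: ui.
by case: eqP => [<-|_]; rewrite // add0n lt0n.
Qed.

Lemma comp_dim_SI0 (K : fieldType) (n : nat) : comp_dim (SI_gmodule K n) 0%:Z 1.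
Proof.
apply: (comp_dim_monomial_quotient (@Igen_homog K n) (@Igen_mon K n)
  (bs := [:: 0%MM])) => // u.
rewrite inE mdeg_eq0; case: eqP => // ->; rewrite Igen_standard.
by apply/esym/orP; left; apply/forallP => j; rewrite mnm0E eqxx orbT.
Qed.

(** In positive degree the monomials in the x's and those in the y's are disjoint families. In
    degree 0 they share the monomial 1, which accounts for [comp_dim_SI0]. *)
Lemma comp_dim_SI (K : fieldType) (n d : nat) :
  comp_dim (SI_gmodule K n) d.+1%:Z (2 * nmon n d.+1).
Proof.
pose bs := embedded_mons (@lshift n n) d.+1 ++ embedded_mons (@rshift n n) d.+1.
have l_inj : injective (@lshift n n) by exact: lshift_inj.
have r_inj : injective (@rshift n n) by exact: rshift_inj.
have -> : (2 * nmon n d.+1)%N = size bs.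
  by rewrite size_cat !size_embedded_mons // mul2n addnn.
apply: (comp_dim_monomial_quotient (@Igen_homog K n) (@Igen_mon K n)) => [|u].
  rewrite cat_uniq !uniq_embedded_mons //= andbT; apply/hasPn => u.
  rewrite !mem_embedded_mons // => /andP[/eqP ud /forallP ur].
  apply/negP => /andP[_ /forallP ul].
  suff u0 : u = 0%MM by rewrite u0 mdeg0 in ud.
  apply/mnmP => j; rewrite mnm0E; case: (split_ordP j) => k ->.
    have := ur (lshift n k); case/orP => [/codomP[i /eqP]|/eqP //].
    by rewrite eq_lrshift.
  have := ul (rshift n k); case/orP => [/codomP[i /eqP]|/eqP //].
  by rewrite eq_rlshift.
by rewrite mem_cat !mem_embedded_mons // Igen_standard -andb_orr.
Qed.

Lemma comp_dim_SI_neg (K : fieldType) (n d : nat) :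
  comp_dim (SI_gmodule K n) (Negz d) 0.
Proof. exact: comp_dim_quotient_neg. Qed.

(** * Direct sums and shifts of graded modules *)

Section DirectSum.
Variables (K : fieldType) (m : nat) (M N : gmodule K m).
Local Notation S := {mpoly K[m]}.
Local Notation MN := (M * N)%type.

Lemma sum_pair (J : Type) (r : seq J) (F : J -> M) (G : J -> N) :
  \sum_(j <- r) ((F j, G j) : MN) = (\sum_(j <- r) F j, \sum_(j <- r) G j).
Proof. by elim: r => [|j r IH]; rewrite ?big_nil // !big_cons IH. Qed.

Definition dsum_comp d (u : MN) := gcomp d u.1 /\ gcomp d u.2.

Fact dsum_comp0 d : dsum_comp d 0.
Proof. by split; exact: gcomp0. Qed.

Fact dsum_compB d u v : dsum_comp d u -> dsum_comp d v -> dsum_comp d (u - v).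
Proof. by move=> [u1 u2] [v1 v2]; split; exact: gcompB. Qed.

Fact dsum_compZ (e : nat) d (p : S) u :
  p \is e.-homog -> dsum_comp d u -> dsum_comp (e%:Z + d) (p *: u).
Proof. by move=> hp [u1 u2]; split; exact: gcompZ. Qed.

Fact dsum_comp_span u : exists (r : seq int) (c : int -> MN),
  (forall d, dsum_comp d (c d)) /\ u = \sum_(d <- r) c d.
Proof.
have [pM [pMc _ _ /(_ u.1)[rM pME]]] := gproj_exists M.
have [pN [pNc _ _ /(_ u.2)[rN pNE]]] := gproj_exists N.
exists (undup (rM ++ rN)), (fun d => (pM d u.1, pN d u.2)); split=> [d|].
  by split; [exact: pMc | exact: pNc].
rewrite sum_pair -pME ?undup_uniq -?pNE ?undup_uniq //; first by case: (u).
  by move=> d dr; rewrite mem_undup mem_cat dr orbT.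
by move=> d dr; rewrite mem_undup mem_cat dr.
Qed.

Fact dsum_comp_free (r : seq int) (c : int -> MN) :
  uniq r -> (forall d, dsum_comp d (c d)) -> \sum_(d <- r) c d = 0 ->
  forall d, d \in r -> c d = 0.
Proof.
move=> ur cc; rewrite (eq_bigr (fun d => ((c d).1, (c d).2))) => [|d _].
  rewrite sum_pair => -[s1 s2] d dr.
  rewrite [c d]surjective_pairing; congr (_, _).
    by apply: gcomp_free s1 _ dr => // e; case: (cc e).
  by apply: gcomp_free s2 _ dr => // e; case: (cc e).
exact: surjective_pairing.
Qed.

Definition dsum : gmodule K m :=
  GModule dsum_comp0 dsum_compB dsum_compZ dsum_comp_span dsum_comp_free.

Lemma dsum_fin_gen : fin_gen M -> fin_gen N -> fin_gen dsum.
Proof.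
move=> [k [g gP]] [l [f fP]].
exists (k + l)%N, (fun i => match split i with
  | inl i => (g i, 0) | inr j => (0, f j) end : dsum) => u.
have [c cE] := gP u.1; have [e eE] := fP u.2.
exists (fun i => match split i with inl i => c i | inr j => e j end).
rewrite big_split_ord /=.
under eq_bigr => i _ do rewrite (unsplitK (inl i)).
under [X in _ + X]eq_bigr => i _ do rewrite (unsplitK (inr i)).
rewrite (eq_bigr (fun i => (c i *: g i, 0 : N))) => [|i _]; last first.
  by congr (_, _); exact: scaler0.
rewrite sum_pair (eq_bigr (fun i => (0 : M, e i *: f i))) => [|i _]; last first.
  by congr (_, _); exact: scaler0.
rewrite sum_pair -cE -eE !big1 //; case: (u) => x y.
by congr (_, _); rewrite ?addr0 ?add0r.
Qed.

Lemma dsum_comp_dim d k l :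
  comp_dim M d k -> comp_dim N d l -> comp_dim dsum d (k + l).
Proof.
move=> [b [bc bP]] [b' [b'c b'P]].
pose B i : dsum := match split i with inl i => (b i, 0) | inr j => (0, b' j) end.
have BE (c : 'rV[K]_(k + l)) : \sum_i (c 0 i)%:MP *: B i =
    (\sum_i (lsubmx c 0 i)%:MP *: b i, \sum_i (rsubmx c 0 i)%:MP *: b' i) :> MN.
  rewrite big_split_ord /= /B.
  under eq_bigr => i _ do rewrite (unsplitK (inl i)).
  under [X in _ + X]eq_bigr => i _ do rewrite (unsplitK (inr i)).
  rewrite (eq_bigr (fun i => ((lsubmx c 0 i)%:MP *: b i, 0 : N))) => [|i _]; last first.
    by rewrite mxE; congr (_, _); exact: scaler0.
  rewrite sum_pair (eq_bigr (fun i => (0 : M, (rsubmx c 0 i)%:MP *: b' i))) => [|i _].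
    by rewrite sum_pair !big1_eq; congr (_, _); rewrite ?addr0 ?add0r.
  by rewrite mxE; congr (_, _); exact: scaler0.
exists B; split=> [i|u [u1 u2]].
  by rewrite /B; case: (split i) => j; split=> //=; exact: gcomp0.
have [c [cE cU]] := bP _ u1; have [e [eE eU]] := b'P _ u2.
exists (row_mx c e); split.
  by rewrite BE row_mxKl row_mxKr -cE -eE; case: (u).
move=> v; rewrite BE => uE; rewrite -[v]hsubmxK; congr row_mx.
  by apply: cU; rewrite uE.
by apply: eU; rewrite uE.
Qed.

Lemma dsum_in_mul (fs : seq S) (u : M) (v : N) :
  in_mul fs ((u, v) : dsum) <-> in_mul fs u /\ in_mul fs v.
Proof.
split=> [[c E] | [[c ->] [e ->]]]; last first.
  by exists (fun i => (c i, e i)); rewrite -sum_pair.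
have : (u, v) = (\sum_(i < size fs) fs`_i *: (c i).1,
                 \sum_(i < size fs) fs`_i *: (c i).2) :> MN.
  by rewrite E -sum_pair; apply: eq_bigr => i _; case: (c i).
move=> [-> ->]; split; first by exists (fun i => (c i).1).
by exists (fun i => (c i).2).
Qed.

End DirectSum.

Section Shift.
Variables (K : fieldType) (m : nat) (M : gmodule K m).
Local Notation S := {mpoly K[m]}.

(** The grading of M(-1), whose Hilbert series is t times that of M. *)
Definition shift_comp (d : int) (u : M) := gcomp (d - 1) u.

Fact shift_comp0 d : shift_comp d 0.
Proof. exact: gcomp0. Qed.

Fact shift_compB d u v : shift_comp d u -> shift_comp d v -> shift_comp d (u - v).
Proof. exact: gcompB. Qed.

Fact shift_compZ (e : nat) d (p : S) u :
  p \is e.-homog -> shift_comp d u -> shift_comp (e%:Z + d) (p *: u).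
Proof. by move=> hp du; rewrite /shift_comp -addrA; exact: gcompZ. Qed.

Fact shift_comp_span u : exists (r : seq int) (c : int -> M),
  (forall d, shift_comp d (c d)) /\ u = \sum_(d <- r) c d.
Proof.
have [r [c [cc ->]]] := gcomp_span u.
exists [seq d + 1 | d <- r], (fun d => c (d - 1)); split=> [d|]; first exact: cc.
by rewrite big_map; apply: eq_bigr => d _; rewrite addrK.
Qed.

Fact shift_comp_free (r : seq int) (c : int -> M) :
  uniq r -> (forall d, shift_comp d (c d)) -> \sum_(d <- r) c d = 0 ->
  forall d, d \in r -> c d = 0.
Proof.
move=> ur cc s0 d dr; rewrite -[d](subrK 1).
apply: (gcomp_free (r := [seq d - 1 | d <- r]) (c := fun d => c (d + 1))).
- by rewrite map_inj_uniq //; exact: addIr.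
- by move=> e; have := cc (e + 1); rewrite /shift_comp addrK.
- by rewrite big_map -[RHS]s0; apply: eq_bigr => e _; rewrite subrK.
- exact: map_f.
Qed.

Definition shift_gmodule : gmodule K m :=
  GModule shift_comp0 shift_compB shift_compZ shift_comp_span shift_comp_free.

End Shift.

(** * Realising Hilbert functions by modules on which x_1, ..., x_r is regular *)

Definition seqshift (f : nat -> nat) (d : nat) : nat :=
  if d is e.+1 then f e else 0%N.

Section RegularHilbertFunctions.
Variables (K : fieldType) (m r : nat).
Local Notation S := {mpoly K[m]}.
Local Notation vars i := [seq ('X_j : S) | j <- take i (enum 'I_m)].

Definition regular_hilbert (h : nat -> nat) : Prop :=
  exists N : gmodule K m, [/\ fin_gen N, forall d : nat, comp_dim N d%:Z (h d),
    forall d : nat, comp_dim N (Negz d) 0 &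
    forall (i : 'I_m) (u : N), (i < r)%N ->
      in_mul (vars i) (('X_i : S) *: u) -> in_mul (vars i) u].

Lemma regular_hilbertD h h' : regular_hilbert h -> regular_hilbert h' ->
  regular_hilbert (fun d => h d + h' d)%N.
Proof.
move=> [M [Mfg Mp Mn Mreg]] [N [Nfg Np Nn Nreg]]; exists (dsum M N); split.
- exact: dsum_fin_gen.
- by move=> d; exact: dsum_comp_dim.
- by move=> d; exact: (dsum_comp_dim (k := 0) (l := 0)).
- move=> i [u v] lt_ir /dsum_in_mul[uX vX]; apply/dsum_in_mul.
  by split; [exact: Mreg | exact: Nreg].
Qed.

Lemma regular_hilbert_shift h : regular_hilbert h ->
  regular_hilbert (seqshift h).
Proof.
move=> [M [Mfg Mp Mn Mreg]]; exists (shift_gmodule M); split=> //.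
  move=> [|d]; first exact: (Mn 0%N).
  have := Mp d; rewrite (_ : d%:Z = d.+1%:Z - 1) //; by lia.
move=> d; have := Mn d.+1; rewrite (_ : Negz d.+1 = Negz d - 1) //.
by rewrite !NegzE; lia.
Qed.

Lemma regular_hilbert0 : regular_hilbert (fun=> 0%N).
Proof.
(* The zero module, as the quotient of S by the ideal generated by 1. *)
pose g (i : unit) : S := 'X_[0%MM].
have g_homog i : g i \is 0.-homog by rewrite dhomogX /= mdeg0.
exists (quot_gmodule g_homog); split.
- exact: fin_gen_quotient.
- move=> d; apply: (comp_dim_monomial_quotient (mon := fun=> 0%MM) g_homog
    _ (bs := [::])) => // u.
  rewrite in_nil /standard; case: existsP => [|no]; first by rewrite andbF.
  by case: no; exists tt; apply/mnm_lepP => i; rewrite mnm0E.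
- exact: comp_dim_quotient_neg.
- move=> i u _ _; suff -> : u = 0 by exact: in_mul0.
  rewrite -[u]quot_reprK; apply/(quot_pi_eq0 g_homog).
  rewrite (in_monomial_ideal (mon := fun=> 0%MM)) //; apply/allP => v _.
  rewrite negbK; apply/existsP; exists tt.
  by apply/mnm_lepP => j; rewrite mnm0E.
Qed.

Lemma regular_hilbert_nmon s : (r <= s <= m)%N -> regular_hilbert (nmon s).
Proof.
case/andP=> le_rs le_sm; pose J := [pred j : 'I_m | (s <= j)%N].
exists (varquot K J); split.
- exact: fin_gen_quotient.
- move=> d; apply: (@comp_dim_varquot _ _ _ _ (widen_ord le_sm)) =>
    [i j /(congr1 val) ij|j].
    by apply: val_inj; exact: ij.
  rewrite inE -ltnNge; apply/codomP/idP => [[i ->]|lt_j]; first exact: (ltn_ord i).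
  by exists (Ordinal (lt_j : (j < s)%N)); apply: val_inj.
- exact: comp_dim_quotient_neg.
- move=> i u lt_ir; apply: varquot_regular; last first.
    by rewrite inE -ltnNge (leq_trans lt_ir).
  apply/negP => /(map_f val); rewrite map_take val_enum_ord take_iota.
  by rewrite mem_iota add0n /= leq_min ltnn.
Qed.

(** On coefficient sequences this is division by 1 - t, inverse to [bdiff]. *)
Definition psum (f : nat -> nat) (d : nat) : nat := (\sum_(i < d.+1) f i)%N.

Lemma iter_psumD k f g :
  iter k psum (fun d => f d + g d)%N = (fun d => iter k psum f d + iter k psum g d)%N.
Proof.
elim: k => //= k ->; apply/funext => d.
by rewrite /psum big_split.
Qed.

Lemma iter_psum_shift k f : iter k psum (seqshift f) = seqshift (iter k psum f).
Proof.
elim: k => //= k ->; apply/funext => -[|d]; rewrite /psum big_ord_recl ?big_ord0 //.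

Qed.

Lemma psum_nmon s : psum (nmon s) = nmon s.+1.
Proof.
apply/funext; elim=> [|d IH]; first by rewrite /psum big_ord1 !nmon0.
by rewrite nmonS -IH /psum big_ord_recr.
Qed.

Lemma iter_psum_nmon k s : iter k psum (nmon s) = nmon (k + s).
Proof. by elim: k => //= k ->; rewrite psum_nmon. Qed.

(** The Hilbert function of the D-th power of the maximal ideal in p variables. *)
Definition tail (p D k : nat) : nat := if (k < D)%N then 0%N else nmon p k.

(* Monomials of degree > D in p+1 variables either avoid the last variable or
   are a multiple of it. *)
Lemma tail_rec p D :
  tail p.+1 D.+1 = (fun k => tail p D.+1 k + seqshift (tail p.+1 D) k)%N.
Proof.
apply/funext => -[|k]; rewrite /tail //= !ltnS.
by case: ifP => // _; rewrite nmonS addnC.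
Qed.

(** By [tail_rec] the truncation splits into shifted full polynomial rings; dividing by (1-t)^r adds
    r variables to each of them. *)
Lemma regular_hilbert_tail p D :
  (p + r <= m)%N -> regular_hilbert (iter r psum (tail p D)).
Proof.
elim: p D => [|p IHp] D le_m; elim: D => [|D IHD].
- have -> : tail 0 0 = nmon 0 by [].
  by rewrite iter_psum_nmon addn0; apply: regular_hilbert_nmon; rewrite leqnn.
- have -> : iter r psum (tail 0 D.+1) = (fun=> 0%N); last exact: regular_hilbert0.
  have -> : tail 0 D.+1 = (fun=> 0%N).
    by apply/funext => -[|k]; rewrite /tail // nmon0S if_same.
  elim: r => //= k ->; apply/funext => d; exact: big1_eq.
- have -> : tail p.+1 0 = nmon p.+1 by [].
  by rewrite iter_psum_nmon; apply: regular_hilbert_nmon; rewrite leq_addr addnC.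
- rewrite tail_rec iter_psumD iter_psum_shift; apply: regular_hilbertD.
    by apply: IHp; rewrite (leq_trans _ le_m) // leq_add2r.
  exact: regular_hilbert_shift.
Qed.

(** The constant term contributes [q 0] copies of the polynomial ring in r variables; the remaining
    terms form a shifted, shorter sequence. *)
Lemma regular_hilbert_finite T q : (r <= m)%N -> (forall k, (T <= k)%N -> q k = 0%N) ->
  regular_hilbert (iter r psum q).
Proof.
move=> le_m; elim: T q => [|T IH] q q0.
  have -> : q = tail 0 1 by apply/funext => -[|k]; rewrite q0 // /tail nmon0S.
  exact: regular_hilbert_tail.
have -> : q = (fun k => (q 0 * nmon 0 k) + seqshift (q \o succn) k)%N.
  by apply/funext => -[|k] /=; rewrite ?nmon0 ?muln1 ?addn0 // nmon0S muln0.
rewrite iter_psumD iter_psum_shift; apply: regular_hilbertD; last first.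
  by apply: regular_hilbert_shift; apply: IH => k le_k; exact: q0.
elim: (q 0) => [|c IHc].
  have -> : (fun k => 0 * nmon 0 k)%N = tail 0 1.
    by apply/funext => -[|k]; rewrite mul0n // /tail nmon0S.
  exact: regular_hilbert_tail.
have -> : (fun k => c.+1 * nmon 0 k)%N = (fun k => tail 0 0 k + c * nmon 0 k)%N.
  by apply/funext => k; rewrite mulSn.
by rewrite iter_psumD; apply: regular_hilbertD => //; exact: regular_hilbert_tail.
Qed.

(** The shape of (1-t)^r H: beyond degree r the binomial coefficient vanishes, leaving two truncated
    polynomial rings and a finite initial part. *)
Lemma regular_hilbert_eventually p T q : (p + r <= m)%N ->
  (forall k, (T <= k)%N -> q k = (2 * nmon p k)%N) -> regular_hilbert (iter r psum q).
Proof.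
move=> le_m qE.
have -> : q = (fun k => (if (k < T)%N then q k else 0) + (tail p T k + tail p T k))%N.
  apply/funext => k; rewrite /tail; case: ltnP => [_|/qE ->]; first by rewrite !addn0.
  by rewrite add0n mul2n addnn.
rewrite !iter_psumD; apply: regular_hilbertD.
  apply: (regular_hilbert_finite (T := T)) => [|k]; last by rewrite ltnNge => ->.
  by rewrite (leq_trans _ le_m) ?leq_addl.
by apply: regular_hilbertD; exact: regular_hilbert_tail.
Qed.

End RegularHilbertFunctions.

(** * Numerical estimates for the binomial coefficients *)

Lemma nmonSr p k : (k.+1 * nmon p k.+1 = (p + k) * nmon p k)%N.
Proof. by rewrite /nmon addnS -mul_bin_diag. Qed.

Section BinomialRatio.
Variable R : realType.

Lemma binomial_le_nmon (r p : nat) (t : nat -> R) :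
  (forall i, (r - i)%:R <= (p + i)%:R * expR (t i)) ->
  forall k, 'C(r, k)%:R <= (nmon p k)%:R * expR (\sum_(i < k) t i).
Proof.
move=> le_t; elim=> [|k IH]; first by rewrite bin0 nmon0 big_ord0 expR0 mulr1.
rewrite -(ler_pM2l (ltr0Sn R k)) -natrM mul_bin_left mulrA -natrM nmonSr !natrM.
have := ler_pM _ _ (le_t k) IH; move=> /(_ (ler0n _ _) (ler0n _ _)).
by rewrite big_ord_recr /= expRD; congr (_ <= _); ring.
Qed.

Lemma nmon_le_binomial (r p k : nat) (t : nat -> R) :
  (forall i, (i < k)%N -> (p + i)%:R <= (r - i)%:R * expR (- t i)) ->
  (nmon p k)%:R <= 'C(r, k)%:R * expR (- \sum_(i < k) t i).
Proof.
elim: k => [|k IH] le_t; first by rewrite bin0 nmon0 big_ord0 oppr0 expR0 mulr1.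
rewrite -(ler_pM2l (ltr0Sn R k)) -natrM nmonSr mulrA -natrM mul_bin_left !natrM.
have {}IH := IH (fun i lt_ik => le_t i (ltnW lt_ik)).
have := ler_pM _ _ (le_t k (leqnn _)) IH; move=> /(_ (ler0n _ _) (ler0n _ _)).
by rewrite big_ord_recr /= opprD expRD; congr (_ <= _); ring.
Qed.

(** Truncated subtraction discards the negative terms, so the bound is uniform in k. Peeling off the
    first term uses (A+3)^2 - (A+1)^2 = 4(A+2). *)
Lemma sum_arith_tail_le A k : (4 * \sum_(i < k) (A - i.*2) <= A.+1 ^ 2)%N.
Proof.
elim: k A => [|k IH] A; first by rewrite big_ord0.
rewrite big_ord_recl subn0; case: A => [|[|A]].
- by rewrite big1.
- by rewrite big1 // => i _; rewrite lift0 doubleS.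
rewrite (eq_bigr (fun i : 'I_k => A - i.*2)%N) => [|i _]; last first.
  by rewrite lift0 doubleS subSS.
by have := IH A; rewrite -!mulnn; move: (\sum_(i < k) _)%N => S; nia.
Qed.

(** The bound on k keeps every subtraction exact. *)
Lemma sum_arith A k : (k.*2 <= A.+2)%N ->
  (\sum_(i < k) (A - i.*2) = k * (A.+1 - k))%N.
Proof.
elim: k => [|k IH] le_k; first by rewrite big_ord0.
rewrite big_ord_recr /= IH; last by lia.
nia.
Qed.

Lemma ln2_le1 : ln 2 <= 1 :> R.
Proof. by have := @le_ln1Dx R 1; rewrite -[2]/(1 + 1 : R); apply; lra. Qed.

Lemma expR_ln2 : expR (ln 2) = 2 :> R.
Proof. by apply: lnK; rewrite posrE; lra. Qed.

(* Here [A] is [max (r - p) 0], so that [A - 2 i] measures by how much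
   [r - i] exceeds [p + i]. *)
Lemma binomial_le_2nmon (r p : nat) : (0 < p)%N ->
  ((r - p).+1 ^ 2)%:R <= 4 * p%:R * ln 2 :> R \/ (r <= p)%N ->
  forall k, ('C(r, k) <= 2 * nmon p k)%N.
Proof.
move=> p_gt0 le_rp k; pose A := (r - p)%N.
have p0 : 0 < p%:R :> R by rewrite ltr0n.
(* Here (r-i)/(p+i) = 1 + (r-p-2i)/(p+i). Lowering the denominator to p makes the exponents an
   arithmetic progression. *)
have le_t i : (r - i)%:R <= (p + i)%:R * expR ((A - i.*2)%:R / p%:R) :> R.
  apply: le_trans (_ : (p + i)%:R * (1 + (A - i.*2)%:R / p%:R) <= _); last first.
    by rewrite ler_pM2l ?expR_ge1Dx // ltr0n addn_gt0 p_gt0.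
  apply: le_trans (_ : (p + i + (A - i.*2))%:R <= _).
    by rewrite ler_nat /A; lia.
  rewrite natrD mulrDr mulr1 lerD2l mulrA ler_pdivlMr // mulrC ler_wpM2r //.
  by rewrite ler_nat leq_addr.
have := binomial_le_nmon le_t k; rewrite -mulr_suml -natr_sum => le_C.
rewrite -(ler_nat R) (le_trans le_C) // natrM mulrC ler_wpM2r // -expR_ln2.
rewrite ler_expR ler_pdivrMr //.
have := sum_arith_tail_le A k; rewrite -(ler_nat R) natrM => le_S.
case: le_rp => [le_A|le_rp]; first by rewrite mulrC; lra.
rewrite big1 => [|i _]; last by rewrite /A; lia.
by rewrite mulr_ge0 ?ln_ge0 //; lra.
Qed.

(** In the reverse direction (p+i)/(r-i) = 1 - (A-2i)/(r-i), and the denominator is raised to r.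
    With S the sum of the A-2i this gives exp(S/r) <= 2. *)
Lemma le_2nmon_sum (r p k : nat) : (0 < p)%N -> (p <= r)%N ->
  (k.*2 <= (r - p).+2)%N -> ('C(r, k) <= 2 * nmon p k)%N ->
  (k * ((r - p).+1 - k))%:R <= r%:R * ln 2 :> R.
Proof.
move=> p_gt0 le_pr le_k le_C; pose A := (r - p)%N.
have r0 : 0 < r%:R :> R by rewrite ltr0n (leq_trans p_gt0).
have le_t i : (i < k)%N ->
    (p + i)%:R <= (r - i)%:R * expR (- ((A - i.*2)%:R / r%:R)) :> R.
  move=> lt_ik.
  apply: le_trans (_ : (r - i)%:R * (1 - (A - i.*2)%:R / r%:R) <= _); last first.
    by rewrite ler_wpM2l // expR_ge1Dx.
  have -> : (p + i)%:R = (r - i)%:R - (A - i.*2)%:R :> R.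
    by rewrite -natrB; [congr (_%:R)|]; rewrite /A; lia.
  rewrite mulrBr mulr1 lerD2l lerN2 mulrA ler_pdivrMr // mulrC ler_wpM2l //.
  by rewrite ler_nat leq_subr.
have := nmon_le_binomial le_t; rewrite -mulr_suml -natr_sum sum_arith //.
set S := (k * _)%N => le_nmon.
have nmon0' : 0 < (nmon p k)%:R :> R.
  by rewrite ltr0n /nmon bin_gt0; lia.
rewrite mulrC -ler_pdivrMr // -ler_expR expR_ln2 -(ler_pM2l nmon0').
have {}le_C : 'C(r, k)%:R <= 2 * (nmon p k)%:R :> R by rewrite -natrM ler_nat.
rewrite -(ler_pM2r (expR_gt0 (- (S%:R / r%:R)))) -mulrA -expRD subrr expR0 mulr1.
apply: (le_trans le_nmon); rewrite ler_wpM2r ?expR_ge0 // (le_trans le_C) //.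
by rewrite mulrC.
Qed.

End BinomialRatio.

Section Bounds.
Variable R : realType.
Local Notation s n := (Num.sqrt ((n %/ 2)%:R * ln 2) : R).

Lemma ln2_gt0 : 0 < ln 2 :> R.
Proof. by apply: ln_gt0; lra. Qed.

(** From n - 1 <= 2 floor(n/2) <= n; these inequalities remove the floor from all later
    estimates. *)
Lemma sqrt_half_bounds n : [/\ 0 <= s n, 2 * s n ^+ 2 <= n%:R * ln 2 &
  n%:R * ln 2 <= 2 * s n ^+ 2 + ln 2].
Proof.
have l_gt0 := ln2_gt0; rewrite sqr_sqrtr ?mulr_ge0 // ?(ltW l_gt0) //.
have nE := divn_eq n 2; have lt2 := ltn_pmod n (isT : 0 < 2)%N.
have le_q : 2 * (n %/ 2)%:R <= n%:R :> R by rewrite -natrM ler_nat; lia.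
have ge_q : n%:R <= 2 * (n %/ 2)%:R + 1 :> R by rewrite -natrM natr1 ler_nat; lia.
by split; [exact: sqrtr_ge0 | nra | nra].
Qed.

Lemma binomial_le_2nmon_of_bound (n r : nat) : r%:R <= n%:R / 2 + s n - 1 ->
  (r < n)%N /\ forall k, ('C(r, k) <= 2 * nmon (n - r) k)%N.
Proof.
have [s_ge0 le_s ge_s] := sqrt_half_bounds n.
have l_gt0 := ln2_gt0; have l_le1 := ln2_le1 R.
move: (s n) s_ge0 le_s ge_s => t t_ge0 le_t ge_t le_r.
have n_ge0 : 0 <= n%:R :> R by [].
have lt_rn : (r < n)%N.
  rewrite ltnNge -(ler_nat R); apply/negP => le_nr.
  have : n%:R * ln 2 <= n%:R :> R by nra.
  have : n%:R / 2 + 1 <= t by lra.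
  nra.
split=> // k; apply: (binomial_le_2nmon (R := R)); first by rewrite subn_gt0.
have [le_rp|lt_pr] := leqP r (n - r); [by right | left].
(* With x = 2r-n+1 the hypothesis reads x <= 2s-1, and the goal becomes x^2 <= 2(n-x+1) ln 2. *)
have AE : (r - (n - r)).+1%:R = 2 * r%:R - n%:R + 1 :> R.
  have -> : (r - (n - r)).+1 = (2 * r + 1 - n)%N by lia.
  by rewrite natrB ?natrD ?natrM; [ring | lia].
have A_ge2 : 2 <= 2 * r%:R - n%:R + 1 :> R by rewrite -AE ler_nat; lia.
rewrite natrX AE natrB; last exact: ltnW.
nra.
Qed.

(** Only even k are assumed: for odd k the coefficient of (1-t)^r H is nonnegative in any case. *)
Lemma bound_of_binomial_le_2nmon (n r : nat) : (2 <= n)%N -> (r < n)%N ->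
  (forall k, ('C(r, k.*2) <= 2 * nmon (n - r) k.*2)%N) ->
  r%:R <= (n + 1)%:R / 2 + s n.
Proof.
move=> n_ge2 lt_rn le_C; rewrite leNgt; apply/negP.
have [s_ge0 le_s ge_s] := sqrt_half_bounds n.
have l_gt0 := ln2_gt0; have l_le1 := ln2_le1 R.
have n2 : 2 <= n%:R :> R by rewrite ler_nat.
(* Here n >= 2 enters; the final estimate absorbs a term 4 ln 2 into 4t by this inequality. *)
have le_ls : ln 2 <= s n.
  rewrite -(ler_pXn2r (ltn0Sn 1)) ?nnegrE ?(ltW l_gt0) //.
  have q_ge1 : 1 <= (n %/ 2)%:R :> R by rewrite ler1n divn_gt0.
  by rewrite sqr_sqrtr ?mulr_ge0 ?(ltW l_gt0) //; nra.
move: (s n) s_ge0 le_s ge_s le_ls => t t_ge0 le_t ge_t le_lt.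
rewrite natrD => lt_r.
have le_pr : (n - r <= r)%N.
  have : n%:R <= (2 * r)%:R :> R by rewrite natrM; lra.
  by rewrite ler_nat; lia.
(* The even number k = 2j is nearest to (A+1)/2, where k(A+1-k) is largest. As A+1-2k lies between
   -1 and 2, four times the product falls short of (A+1)^2 by at most 4. *)
pose A := (r - (n - r))%N; pose j := ((A + 2) %/ 4)%N.
have jE := divn_eq (A + 2) 4; have j_lt := ltn_pmod (A + 2) (isT : 0 < 4)%N.
rewrite -/j in jE.
have le_j : (j.*2.*2 <= A.+2)%N by lia.
have p_gt0 : (0 < n - r)%N by rewrite subn_gt0.
have := le_2nmon_sum R p_gt0 le_pr le_j (le_C j); rewrite -/A => le_S.
have ge_S : (A.+1 * A.+1 <= 4 * (j.*2 * (A.+1 - j.*2)) + 4)%N by nia.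
have AE : A.+1%:R = 2 * r%:R - n%:R + 1 :> R.
  have -> : A.+1 = (2 * r + 1 - n)%N by rewrite /A; lia.
  by rewrite natrB ?natrD ?natrM; [ring | lia].
have {}ge_S : A.+1%:R * A.+1%:R <= 4 * (j.*2 * (A.+1 - j.*2))%:R + 4 :> R.
  by rewrite -!natrM -natrD ler_nat.
rewrite AE in ge_S.
have lt_x : 2 + 2 * t < 2 * r%:R - n%:R + 1 by lra.
have rE : 2 * r%:R = n%:R + (2 * r%:R - n%:R + 1) - 1 :> R by ring.
move: (2 * r%:R - n%:R + 1 : R) ge_S lt_x rE => x ge_S lt_x rE.
have le_x : x * x - 4 <= 2 * (n%:R + x - 1) * ln 2 by rewrite -rE; lra.
have : x * x - 4 <= 4 * t ^+ 2 + 2 * x * ln 2 by lra.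
pose d := x - 2 - 2 * t; have d_gt0 : 0 < d by rewrite /d; lra.
have -> : x = 2 + 2 * t + d by rewrite /d; ring.
have : t * ln 2 <= t by nra.
have : d * ln 2 <= d by nra.
have : 0 <= d * t by nra.
have : 0 <= d * d by nra.
nra.
Qed.

End Bounds.

(** * The Hilbert series of S/I and its Hilbert depth *)

Definition SI_hilbert (n d : nat) : nat := if d is 0 then 1%N else (2 * nmon n d)%N.

(** As H = 2/(1-t)^n - 1, the product (1-t)^r H is 2/(1-t)^(n-r) - (1-t)^r. *)
Lemma iter_bdiff_SI_hilbert (n r : nat) : (r <= n)%N -> forall k,
  iter r bdiff (fun d => (SI_hilbert n d)%:Z) k =
  (2 * nmon (n - r) k)%:Z - (-1) ^+ k * ('C(r, k))%:Z.
Proof.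
elim: r => [|r IH] lt_rn k.
  rewrite /= subn0; case: k => [|k] /=; first by rewrite nmon0 bin0.
  by rewrite bin0n mulr0 subr0.
rewrite iterS; have {}IH := IH (ltnW lt_rn); case: k => [|k] /=.
  by rewrite IH !nmon0 !bin0.
rewrite !IH exprS binS; have -> : (n - r = (n - r.+1).+1)%N by lia.
by rewrite nmonS !PoszM !PoszD; ring.
Qed.

Lemma iter_bdiff_seqshift r (f : nat -> int) k :
  iter r bdiff (fun d => if d is e.+1 then f e else 0) k =
  if k is e.+1 then iter r bdiff f e else 0.
Proof.
elim: r k => [//|r IH] [|k] /=; first by rewrite IH.
by rewrite !IH; case: k => [|k] //=; rewrite subr0.
Qed.

Lemma iter_psum_bdiff r (f : nat -> int) (q : nat -> nat) :
  (forall k, (q k)%:Z = iter r bdiff f k) -> forall k, (iter r psum q k)%:Z = f k.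
Proof.
elim: r q => [|r IH] q qE; first exact: qE.
rewrite iterSr; apply: IH; elim=> [|k IHk]; first by rewrite /psum big_ord1 qE.
rewrite /psum big_ord_recr PoszD -/(psum q k) IHk qE /=.
by rewrite addrC subrK.
Qed.

Lemma exists_max (P : nat -> Prop) (B : nat) : (exists r, P r) ->
  (forall r, P r -> (r <= B)%N) -> exists h, P h /\ forall r, P r -> (r <= h)%N.
Proof.
move=> exP leB.
have exb : exists r, `[< P r >] by case: exP => r Pr; exists r; apply/asboolP.
have ub r : `[< P r >] -> (r <= B)%N by move/asboolP/leB.
have [h /asboolP Ph h_max] := ex_maxnP exb ub.
by exists h; split=> // r /asboolP; exact: h_max.
Qed.

Section HilbertDepth.
Variables (K : fieldType) (R : realType) (n : nat).
Hypothesis n_ge2 : (2 <= n)%N.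
Local Notation S := {mpoly K[n + n]}.
Local Notation s := (Num.sqrt ((n %/ 2)%:R * ln 2) : R).

Lemma same_hilbert_comp_dim (N : gmodule K (n + n)) :
  same_hilbert_series N (SI_gmodule K n) <->
  (forall d : nat, comp_dim N d%:Z (SI_hilbert n d)) /\
  (forall d : nat, comp_dim N (Negz d) 0).
Proof.
have M_dim (d : nat) : comp_dim (SI_gmodule K n) d%:Z (SI_hilbert n d).
  by case: d => [|d]; [exact: comp_dim_SI0 | exact: comp_dim_SI].
split=> [sameN | [N_dim N_neg] [d|d]]; last first.
- by exists 0%N; split=> //; exact: comp_dim_SI_neg.
- by exists (SI_hilbert n d).
split=> d.
  by have [k [Nk Mk]] := sameN d%:Z; rewrite (comp_dim_uniq (M_dim d) Mk).
have [k [Nk Mk]] := sameN (Negz d).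
by rewrite (comp_dim_uniq (comp_dim_SI_neg K n d) Mk).
Qed.

Lemma regular_seq_bound (N : gmodule K (n + n)) (fs : seq S) :
  same_hilbert_series N (SI_gmodule K n) ->
  {subset fs <= max_ideal (K := K) (m := n + n)} -> regular_seq N fs ->
  (size fs)%:R <= (n + 1)%:R / 2 + s.
Proof.
move=> /same_hilbert_comp_dim[N_dim N_neg] fs_max fs_reg.
have h_dim (d : nat) : comp_dim N (d%:Z - 1) (seqshift (SI_hilbert n) d).
  case: d => [|d]; first exact: (N_neg 0%N).
  by have := N_dim d; rewrite (_ : d%:Z = d.+1%:Z - 1) //; lia.
have ge0 r k : (r <= size fs)%N -> (r <= n)%N ->
    0 <= (2 * nmon (n - r) k)%:Z - (-1) ^+ k * ('C(r, k))%:Z.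
  move=> le_r le_rn; rewrite -iter_bdiff_SI_hilbert //.
  have := regular_seq_bdiff_ge0 h_dim erefl fs_max fs_reg k.+1 le_r.
  rewrite (_ : (fun d => (seqshift (SI_hilbert n) d)%:Z) =
    (fun d => if d is e.+1 then (SI_hilbert n e)%:Z else 0)).
    by rewrite iter_bdiff_seqshift.
  by apply/funext => -[].
(* For r = n the coefficient of t^2 is -C(n, 2), which is negative. *)
have lt_n : (size fs < n)%N.
  rewrite ltnNge; apply/negP => le_n; have := ge0 n 2%N le_n (leqnn n).
  rewrite subnn nmon0S muln0 sqrrN expr1n mul1r sub0r oppr_ge0 lez_nat leqn0.
  by rewrite -leqn0 leqNgt bin_gt0 n_ge2.
apply: bound_of_binomial_le_2nmon => // k.
have := ge0 _ k.*2 (leqnn _) (ltnW lt_n).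
by rewrite -signr_odd odd_double mul1r subr_ge0 lez_nat.
Qed.

Lemma exists_depth_ge (r : nat) : r%:R <= n%:R / 2 + s - 1 ->
  exists (N : gmodule K (n + n)) (fs : seq S),
    [/\ fin_gen N, same_hilbert_series N (SI_gmodule K n),
        {subset fs <= max_ideal (K := K) (m := n + n)}, regular_seq N fs &
        size fs = r].
Proof.
move=> /binomial_le_2nmon_of_bound[lt_rn le_C].
pose f d := (SI_hilbert n d)%:Z.
pose q k := `|iter r bdiff f k|%N.
have qE k : (q k)%:Z = iter r bdiff f k.
  rewrite /q gez0_abs // iter_bdiff_SI_hilbert ?(ltnW lt_rn) // subr_ge0.
  apply: le_trans (_ : ('C(r, k))%:Z <= _); last by rewrite lez_nat.
  by rewrite -signr_odd; case: (odd k); rewrite ?mul1r // mulN1r; lia.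
have HE : iter r psum q = SI_hilbert n.
  by apply/funext => k; have := iter_psum_bdiff qE k => -[].
have : regular_hilbert K (n + n) r (SI_hilbert n).
  rewrite -HE; apply: (@regular_hilbert_eventually _ _ _ (n - r) r.+1).
    by lia.
  move=> k lt_rk; apply/eqP; rewrite -eqz_nat qE iter_bdiff_SI_hilbert ?(ltnW lt_rn) //.
  by rewrite bin_small // mulr0 subr0.
case=> N [N_fg N_dim N_neg N_reg].
pose fs := [seq ('X_j : S) | j <- take r (enum 'I_(n + n))].
have sz_take : size (take r (enum 'I_(n + n))) = r.
  by rewrite size_takel // size_enum_ord; lia.
have sz : size fs = r by rewrite size_map.
exists N, fs; split=> //; first by apply/same_hilbert_comp_dim.
  move=> _ /mapP[j _ ->]; apply/asboolP; exists (fun i => (i == j)%:R).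
  rewrite (bigD1 j) //= eqxx mul1r big1 ?addr0 // => i /negPf ->.
  by rewrite mul0r.
split=> [i|].
  rewrite sz => lt_ir u.
  have lt_i : (i < n + n)%N by lia.
  have -> : take i fs = [seq ('X_j : S) | j <- take i (enum 'I_(n + n))].
    by rewrite -map_take take_takel // ltnW.
  have -> : fs`_i = 'X_(Ordinal lt_i).
    rewrite (nth_map (Ordinal lt_i)) ?sz_take // nth_take //; congr 'X_ _.
    by apply: val_inj; rewrite /= nth_enum_ord.
  exact: (N_reg (Ordinal lt_i)).
(* Properness: if the basis element of N_0 lay in (x_1, ..., x_r)N, its degree 0 part would be a sum
   of variables times elements of N_(-1) = 0. *)
have [b [bc bP]] := N_dim 0%N; exists (b ord0) => -[c cE].
have [pi [pi_c pi_id piX _]] := gproj_exists N.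
have b0 : b ord0 = 0.
  rewrite -(pi_id 0 _ (bc ord0)) cE raddf_sum big1 // => i _.
  have /mapP[j _ ->] : fs`_i \in fs by exact: mem_nth.
  have := piX (-1) j (c i); rewrite (_ : 1 + -1 = 0%:Z) // => ->.
  have [b' [_ b'P]] := N_neg 0%N.
  have [v [-> _]] := b'P _ (pi_c (-1) (c i)).
  by rewrite big_ord0 scaler0.
have [v [_ vP]] := bP 0 (gcomp0 N 0%:Z).
have v1 : v = const_mx 1 by apply: vP; rewrite big_ord1 b0 scaler0.
have v0 : v = 0 by apply: vP; rewrite big_ord1 b0 scaler0.
have /matrixP/(_ 0 ord0) : const_mx 1 = 0 :> 'rV[K]_1 by rewrite -v1 v0.
by rewrite !mxE => /eqP; rewrite oner_eq0.
Qed.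

(** The maximum defining the depth is attained because [regular_seq_bound] bounds all lengths. *)
Lemma exists_is_depth (N : gmodule K (n + n)) (fs : seq S) :
  same_hilbert_series N (SI_gmodule K n) ->
  {subset fs <= max_ideal (K := K) (m := n + n)} -> regular_seq N fs ->
  exists2 h, is_depth N h & (size fs <= h)%N.
Proof.
move=> sameN fs_max fs_reg.
pose P r := exists fs : seq S, [/\ {subset fs <= max_ideal (K := K) (m := n + n)},
  regular_seq N fs & size fs = r].
have [||h [Ph h_max]] := @exists_max P (Num.truncn ((n + 1)%:R / 2 + s)).
- by exists (size fs), fs.
- move=> _ [gs [gs_max gs_reg <-]].
  have le_gs := regular_seq_bound sameN gs_max gs_reg.
  by rewrite truncn_ge_nat ?(le_trans _ le_gs).
exists h; last by apply: h_max; exists fs.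
by split=> // gs gs_max gs_reg; apply: h_max; exists gs.
Qed.

Lemma exists_hdepth : exists h : nat, is_hdepth (SI_gmodule K n) h /\
  Num.floor (n%:R / 2 + s) - 1 <= h%:Z <= Num.floor ((n + 1)%:R / 2 + s).
Proof.
have s_ge0 : 0 <= s by exact: sqrtr_ge0.
have n2 : 2 <= n%:R :> R by rewrite ler_nat.
pose x := n%:R / 2 + s; have x_ge1 : 1 <= x by rewrite /x; lra.
(* Since n/2 >= 1, the lower bound is a natural number and can serve as the length r. *)
have L_ge0 : 0 <= Num.floor x - 1 by rewrite subr_ge0 floor_ge_int.
pose r := `|Num.floor x - 1|%N.
have rE : r%:Z = Num.floor x - 1 by rewrite /r gez0_abs.
have le_r : r%:R <= n%:R / 2 + s - 1.
  by rewrite -/x -[_%:R]/(r%:Z%:~R) rE intrB lerD2r floor_le.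
have [N [fs [N_fg sameN fs_max fs_reg fs_sz]]] := exists_depth_ge le_r.
have [h0 h0_depth le_h0] := exists_is_depth sameN fs_max fs_reg.
pose P h := exists N : gmodule K (n + n),
  [/\ fin_gen N, same_hilbert_series N (SI_gmodule K n) & is_depth N h].
have leP h : P h -> h%:R <= (n + 1)%:R / 2 + s.
  by case=> N' [_ sameN' [[gs [gs_max gs_reg <-]] _]]; exact: regular_seq_bound gs_reg.
have [||h [Ph h_max]] := @exists_max P (Num.truncn ((n + 1)%:R / 2 + s)).
- by exists h0, N.
- by move=> k /leP le_k; rewrite truncn_ge_nat ?(le_trans _ le_k).
exists h; split; first by split=> // N' k *; apply: h_max; exists N'.
rewrite -rE lez_nat floor_ge_int; apply/andP; split; last exact: leP.
by rewrite -fs_sz (leq_trans le_h0) // h_max //; exists N.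
Qed.

End HilbertDepth.

Theorem theorem3p2 (K : fieldType) (R : realType) (n : nat) (hn : (2 <= n)%N) :
  exists h : nat, is_hdepth (SI_gmodule K n) h /\
    Num.floor (n%:R / 2 + Num.sqrt ((n %/ 2)%:R * ln 2) : R) - 1 <= h%:Z
      <= Num.floor ((n + 1)%:R / 2 + Num.sqrt ((n %/ 2)%:R * ln 2) : R).
Proof. exact: exists_hdepth. Qed.
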